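(* Let $X$ and $Y$ be infinite dimensional complex Banach spaces. An additive surjective map $\varphi:\mathcal{B}(X)\to\mathcal{B}(Y)$ satisfies $\mathrm{M}(\varphi(T))=\mathrm{M}(T)$ for all $T\in\mathcal{B}(X)$ if and only if one of the following holds: (1) there are bijective isometries $U:X\to Y$ and $V:Y\to X$, both linear or both conjugate linear, such that $\varphi(T)=UTV$ for all $T\in\mathcal{B}(X)$; or (2) there are bijective isometries $U:X^*\to Y$ and $V:Y\to X^*$, both linear or both conjugate linear, such that $\varphi(T)=UT^*V$ for all $T\in\mathcal{B}(X)$. Moreover, case (2) cannot occur if any one of $X$ and $Y$ is not reflexive.
   Context: For a complex Banach space $Z$, $\mathcal{B}(Z)$ denotes the algebra of all bounded linear operators on $Z$, $Z^*$ its (topological) dual space, and $B_Z$ its closed unit ball. A map $\varphi$ is additive if $\varphi(S+T)=\varphi(S)+\varphi(T)$ for all $S,T$ (no homogeneity is assumed). For $T\in\mathcal{B}(X)$, $T^*\in\mathcal{B}(X^* )$ is the Banach space adjoint of $T$. A map $U$ between complex vector spaces is conjugate linear if it is additive and $U(\lambda x)=\overline{\lambda}Ux$ for all scalars $\lambda$ and vectors $x$. For $T\in\mathcal{B}(Z)$, the minimum modulus and the surjectivity modulus of $T$ are respectively $$\mathrm{m}(T):=\inf\{\|Tz\|:\ z\in Z,\ \|z\|=1\},\qquad \mathrm{q}(T):=\sup\{\varepsilon\geq 0:\ \varepsilon B_Z\subseteq T(B_Z)\},$$ and the maximum modulus of $T$ is $\mathrm{M}(T):=\max(\mathrm{m}(T),\mathrm{q}(T))$.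 *)

(* Defs.v *)
From HB Require Import structures.
From mathcomp Require Import all_boot all_order all_algebra.
From mathcomp Require Import complex.
From mathcomp Require Import all_classical all_reals all_analysis.

Set Implicit Arguments.
Unset Strict Implicit.
Unset Printing Implicit Defensive.

Import Order.TTheory GRing.Theory Num.Theory.
Import numFieldNormedType.Exports.

Local Open Scope classical_set_scope.
Local Open Scope ring_scope.
Local Open Scope complex_scope.

(* A complex Banach space over the complex numbers R[i] (R : realType) is a
   [completeNormedModType R[i]].  Its norm takes values in R[i]; [rnorm] is the
   same norm, read as an element of R, where infima and suprema are available. *)
Section RealNorm.
Context {R : realType} {V : normedModType R[i]}.
Implicit Types x y : V.

Definition rnorm x : R := complex.Re `|x|.

Lemma rnormE x : (rnorm x)%:C = `|x|.
Proof. by rewrite /rnorm RRe_real// normr_real. Qed.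

Lemma rnorm_ge0 x : 0 <= rnorm x.
Proof. by rewrite -lecR rnormE; exact: normr_ge0. Qed.

Lemma rnorm_le x (M : R) : (rnorm x <= M) = (`|x| <= M%:C).
Proof. by rewrite -lecR rnormE. Qed.

Lemma rnormD x y : rnorm (x + y) <= rnorm x + rnorm y.
Proof. by rewrite -lecR rmorphD/= !rnormE ler_normD. Qed.

Lemma rnorm0 : rnorm 0 = 0.
Proof. by rewrite /rnorm normr0. Qed.

Lemma rnorm0_eq0 x : rnorm x = 0 -> x = 0.
Proof. by move=> x0; apply/normr0_eq0; rewrite -rnormE x0. Qed.

Definition unit_ball : set V := [set x | rnorm x <= 1].
Definition unit_sphere : set V := [set x | rnorm x = 1].

End RealNorm.
Arguments unit_ball {R} V.
Arguments unit_sphere {R} V.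

Section RealNormScale.
Context {R : realType}.

Lemma Re_normE (a : R[i]) : (complex.Re `|a|)%:C = `|a|.
Proof. by rewrite RRe_real// normr_real. Qed.

Lemma Re_norm_ge0 (a : R[i]) : 0 <= complex.Re `|a|.
Proof. by rewrite -lecR Re_normE; exact: normr_ge0. Qed.

Lemma rnormZ (V : normedModType R[i]) (a : R[i]) (x : V) :
  rnorm (a *: x) = complex.Re `|a| * rnorm x.
Proof.
apply: (@complexI R).
have realcM (b c : R) : (b * c)%:C = b%:C * c%:C by exact: rmorphM.
by rewrite realcM !rnormE normrZ Re_normE.
Qed.

Lemma rnormZR (V : normedModType R[i]) (a : R) (x : V) :
  0 <= a -> rnorm (a%:C *: x) = a * rnorm x.
Proof. by move=> a0; rewrite rnormZ ger0_norm ?lecR. Qed.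

End RealNormScale.

Section BoundedOperators.
Context {R : realType} {V W : normedModType R[i]}.

Definition bounded_linear (f : V -> W) : Prop :=
  linear f /\ exists M : R, forall x, rnorm (f x) <= M * rnorm x.

Definition bounded_linear_pred : {pred V -> W} := mem [set f | bounded_linear f].

Lemma bounded_linear_submod : submod_closed bounded_linear_pred.
Proof.
split=> [|a f g].
  rewrite inE; split=> [b x y|]; first by rewrite /= scaler0 addr0.
  by exists 0 => x; rewrite mul0r rnorm0.
rewrite !inE => -[lf [M fM]] [lg [N gN]]; split=> [b x y|].
  rewrite !addrfctE !scalrfctE /= lf lg !scalerDr !scalerA.
  by rewrite [a * b]mulrC addrACA.
exists (complex.Re `|a| * M + N) => x; rewrite !addrfctE !scalrfctE /=.
rewrite (le_trans (rnormD _ _))// mulrDl lerD// rnormZ -mulrA ler_wpM2l//.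
exact: Re_norm_ge0.
Qed.

HB.instance Definition _ :=
  GRing.isSubmodClosed.Build _ _ bounded_linear_pred bounded_linear_submod.

Record bop := Bop {
  bop_fun :> V -> W;
  bop_boundedP : bop_fun \in bounded_linear_pred }.

HB.instance Definition _ := [isSub for bop_fun].
HB.instance Definition _ := [Choice of bop by <:].
HB.instance Definition _ := [SubChoice_isSubLmodule of bop by <:].

Implicit Types f g : bop.

Lemma bopP f : bounded_linear f.
Proof. by have := bop_boundedP f; rewrite inE. Qed.

HB.instance Definition _ f :=
  GRing.isLinear.Build R[i] V W *:%R (bop_fun f) (bopP f).1.

Definition mk_bop (f : V -> W) (bf : bounded_linear f) : bop := Bop (mem_set bf).

Lemma bop_ext f g : f =1 g -> f = g.
Proof. by move=> fg; apply/val_inj/funext. Qed.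

Lemma bopDE f g x : (f + g) x = f x + g x. Proof. by []. Qed.
Lemma bopZE (a : R[i]) f x : (a *: f) x = a *: f x. Proof. by []. Qed.

Definition opnorm f : R := sup [set rnorm (f x) | x in unit_ball V].

Lemma opnorm_has_sup f : has_sup [set rnorm (f x) | x in unit_ball V].
Proof.
have [_ [M fM]] := bopP f; split.
  by exists (rnorm (f 0)), 0; rewrite /unit_ball/= ?rnorm0.
exists `|M| => _ [x x1 <-]; rewrite (le_trans (fM x))//.
rewrite (le_trans (ler_wpM2r (rnorm_ge0 x) (ler_norm M)))//.
by rewrite ler_piMr.
Qed.

Lemma opnorm_ub f x : rnorm x <= 1 -> rnorm (f x) <= opnorm f.
Proof. by move=> x1; apply: sup_upper_bound; [exact: opnorm_has_sup|exists x]. Qed.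

Lemma opnorm_le f (M : R) :
  (forall x, rnorm x <= 1 -> rnorm (f x) <= M) -> opnorm f <= M.
Proof.
move=> fM; apply: ge_sup; first by case: (opnorm_has_sup f).
by move=> _ [x x1 <-]; exact: fM.
Qed.

Lemma opnorm_ge0 f : 0 <= opnorm f.
Proof.
by apply: le_trans (rnorm_ge0 (f 0)) (opnorm_ub _ _); rewrite rnorm0.
Qed.

Lemma opnormP f x : rnorm (f x) <= opnorm f * rnorm x.
Proof.
have [->|x0] := eqVneq x 0; first by rewrite linear0 !rnorm0 mulr0.
have r0 : 0 < rnorm x.
  rewrite lt_neqAle rnorm_ge0 andbT eq_sym.
  by apply: contra_neq x0; exact: rnorm0_eq0.
rewrite -ler_pdivrMr// mulrC -rnormZR ?invr_ge0 ?rnorm_ge0//.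
rewrite -linearZ/= opnorm_ub// rnormZR ?invr_ge0 ?rnorm_ge0//.
by rewrite mulVf// gt_eqF.
Qed.

Let bnorm f : R[i] := (opnorm f)%:C.

Let bnormD f g : bnorm (f + g) <= bnorm f + bnorm g.
Proof.
rewrite /bnorm -rmorphD lecR; apply: opnorm_le => x x1.
by rewrite bopDE (le_trans (rnormD _ _))// lerD// opnorm_ub.
Qed.

Let bnormZ (a : R[i]) f : bnorm (a *: f) = `|a| * bnorm f.
Proof.
have a0 := Re_norm_ge0 a.
rewrite /bnorm -(Re_normE a) -rmorphM; congr (_%:C).
apply/eqP; rewrite eq_le; apply/andP; split.
  by apply: opnorm_le => x x1; rewrite bopZE rnormZ ler_wpM2l// opnorm_ub.
have [->|an0] := eqVneq (complex.Re `|a|) 0.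
  by rewrite mul0r opnorm_ge0.
have ap : 0 < complex.Re `|a| by rewrite lt_neqAle eq_sym an0.
rewrite mulrC -ler_pdivlMr//; apply: opnorm_le => x x1.
by rewrite ler_pdivlMr// mulrC -rnormZ -bopZE opnorm_ub.
Qed.

Let bnorm_eq0 f : bnorm f = 0 -> f = 0.
Proof.
move=> /(@complexI R) f0; apply: bop_ext => x; apply: rnorm0_eq0.
by apply/eqP; rewrite eq_le rnorm_ge0 andbT (le_trans (opnormP f x))// f0 mul0r.
Qed.

HB.instance Definition _ :=
  Lmodule_isNormed.Build R[i] bop bnormD bnormZ bnorm_eq0.

Lemma bop_rnormE f : rnorm f = opnorm f.
Proof. by []. Qed.

End BoundedOperators.
Arguments bop {R} V W.

Notation "''B' ( X )" := (bop X X) (at level 8, format "''B' ( X )").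

Definition dual (R : realType) (X : normedModType R[i]) : normedModType R[i] :=
  bop X R[i]^o.

Section Adjoint.
Context {R : realType} {X : normedModType R[i]}.

Lemma adjoint_fun_subproof (T : 'B(X)) (f : dual X) :
  bounded_linear (fun x => f (T x)).
Proof.
split=> [a x y|]; first by rewrite !linearP.
exists (opnorm f * opnorm T) => x; rewrite (le_trans (opnormP f _))//.
by rewrite -mulrA ler_wpM2l ?opnorm_ge0// opnormP.
Qed.

Definition adjoint_fun (T : 'B(X)) (f : dual X) : dual X :=
  mk_bop (adjoint_fun_subproof T f).

Lemma adjoint_subproof (T : 'B(X)) : bounded_linear (adjoint_fun T).
Proof.
split=> [a f g|]; first exact: bop_ext.
exists (opnorm T) => f; rewrite bop_rnormE; apply: opnorm_le => x x1 /=.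
rewrite (le_trans (opnormP f _))// mulrC.
exact: (ler_wpM2r (opnorm_ge0 f) (opnorm_ub T x1)).
Qed.

Definition adjoint (T : 'B(X)) : 'B(dual X) := mk_bop (adjoint_subproof T).

Lemma bidual_fun_subproof (x : X) :
  bounded_linear (fun f : dual X => f x : R[i]^o).
Proof.
split=> [a f g //|].
by exists (rnorm x) => f; rewrite mulrC; exact: opnormP.
Qed.

Definition bidual_embedding (x : X) : dual (dual X) :=
  mk_bop (bidual_fun_subproof x).

End Adjoint.

(* Surjectivity of the canonical map, not mere isometry of X with its bidual. *)
Definition reflexive_space (R : realType) (X : normedModType R[i]) : Prop :=
  range (@bidual_embedding R X) = setT.

Definition infinite_dimensional (R : realType) (X : normedModType R[i]) : Prop :=
  ~ exists (n : nat) (e : 'I_n -> X),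
      forall x : X, exists c : 'I_n -> R[i], x = \sum_(i < n) c i *: e i.

(* The sets below are nonempty and bounded on the relevant side whenever
   Z != 0, so [inf] and [sup] are then the genuine infimum and supremum. *)
Section Moduli.
Context {R : realType} {Z : normedModType R[i]}.
Implicit Type T : 'B(Z).

Definition min_modulus T : R := inf [set rnorm (T z) | z in unit_sphere Z].

Definition surj_modulus T : R :=
  sup [set e : R | 0 <= e /\
         [set e%:C *: z | z in unit_ball Z] `<=` [set T z | z in unit_ball Z]].

Definition max_modulus T : R := Num.max (min_modulus T) (surj_modulus T).

End Moduli.

Section Isometries.
Context {R : realType} {V W : normedModType R[i]}.

Definition conj_linear (U : V -> W) : Prop :=
  {morph U : x y / x + y} /\
  forall (a : R[i]) (x : V), U (a *: x) = conjc a *: U x.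

Definition bijective_isometry (U : V -> W) : Prop :=
  bijective U /\ forall x y, `|U x - U y| = `|x - y|.

End Isometries.

Definition both_linear_or_conj_linear (R : realType)
    (V W V' W' : normedModType R[i]) (U : V -> W) (U' : V' -> W') : Prop :=
  linear U /\ linear U' \/ conj_linear U /\ conj_linear U'.

Section Forms.
Context {R : realType} {X Y : normedModType R[i]}.

Definition direct_form (phi : 'B(X) -> 'B(Y)) : Prop :=
  exists (U : X -> Y) (V : Y -> X),
    [/\ bijective_isometry U, bijective_isometry V,
        both_linear_or_conj_linear U V &
        forall (T : 'B(X)) (y : Y), phi T y = U (T (V y))].

Definition adjoint_form (phi : 'B(X) -> 'B(Y)) : Prop :=
  exists (U : dual X -> Y) (V : Y -> dual X),
    [/\ bijective_isometry U, bijective_isometry V,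
        both_linear_or_conj_linear U V &
        forall (T : 'B(X)) (y : Y), phi T y = U (adjoint T (V y))].

End Forms.

(* Main.v *)
Require Import Defs.
From mathcomp Require Import all_boot all_order all_algebra.
From mathcomp Require Import complex.
From mathcomp Require Import all_classical all_reals all_analysis.
From mathcomp Require Import ring lra.

(** The maximum modulus of T is positive exactly when T is bounded below or
solves T x = y with a linear bound on x ([semi_invertible]); it is the
inverse of the norm of T^-1 when T is invertible. So phi preserves
semi-invertibility in both directions, and the norm of the inverse of an
invertible operator.

Semi-invertibility detects rank one ([rank_le1P]). If T has rank at most one
and A is semi-invertible, then at most one scalar multiple of T destroys the
semi-invertibility of A. If T has larger rank, some invertible A is such that
A + T and A + 2T both have a nonzero kernel and a range annihilated by a
nonzero functional. Hence phi is injective and preserves rank at most one in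
both directions. The maximal additive groups of such operators are the lines:
the rank one operators with a given range, and those with a given kernel. Two
lines of different types share a nonzero operator, two distinct lines of the
same type do not; so phi either respects or exchanges the two types
([line_types]). With (E, F) = (X, dual of X) in the first case and (dual of
X, X) in the second, phi sends the rank one operator given by e and f to the
one given by A e and C f, where A and C are additive and semilinear for the
same map t of scalars ([factorization]).

Let b be the pairing of E with F, and let an invertible T act on E, directly
or through its adjoint. Adding to T the rank one operator given by e and f
leaves T semi-invertible unless b (T^-1 e) f = -1. Reading this on both sides
of phi shows that phi T is invertible and that C f (phi(T)^-1 (A e)) = t (b
(T^-1 e) f) ([phi_inverses]). Comparing with T = 1 gives phi T = A T V, where
V = A^-1 phi(1). This holds for all T, since every operator is the sum of two
invertible ones ([phi_formula]).

The operator V^-1 T A^-1 is the inverse of phi (T^-1), so it has the norm of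
T when T is invertible. On scalars this says that t preserves the modulus, so
that t is the identity or the conjugation; on rank one operators, which are
limits of invertible ones, it says that A and V are multiples of isometries,
by factors inverse to each other ([isometric_form_of_factorization]).

Conversely, isometries do not change the moduli. If phi has the adjoint form
and is surjective, every operator on the dual of X is an adjoint; applied to
the rank one operators built from G in the bidual, this shows that G is an
evaluation, so X is reflexive, and then Y too. For reflexive X, taking the
adjoint exchanges the minimum and the surjectivity modulus
([adjoint_max_modulus]). *)

Set Implicit Arguments.
Unset Strict Implicit.
Unset Printing Implicit Defensive.

Import Order.TTheory GRing.Theory Num.Theory.
Import numFieldNormedType.Exports.
Local Open Scope ring_scope.

(** * Additive maps *)

Section AdditiveMaps.
Context {U V : zmodType} (h : U -> V).
Hypothesis hD : {morph h : x y / x + y}.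

Lemma additive0 : h 0 = 0.
Proof. by apply: (addIr (h 0)); rewrite -hD addr0 add0r. Qed.

Lemma additiveN x : h (- x) = - h x.
Proof. by apply/eqP; rewrite -addr_eq0 -hD addNr additive0. Qed.
End AdditiveMaps.

Lemma nonproportional_neq0 (K : pzRingType) (V : lmodType K) (x y : V) :
  (forall c : K, y <> c *: x) -> y != 0.
Proof. by move=> nxy; apply/eqP => y0; apply: (nxy 0); rewrite scale0r. Qed.

(** * The Hahn-Banach theorem for complex normed spaces *)

Section RealHahnBanach.
Local Open Scope classical_set_scope.
Local Open Scope complex_scope.
Context {R : realType} {V : normedModType R[i]}.
Variable K : R.
Hypothesis K0 : 0 <= K.

(* Partial linear functionals are handled as graphs: unions of chains are then
   plain unions, and domination by the norm makes a linear graph functional. *)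
Let linear_graph (G : set (V * R)) :=
  forall x y r s (a : R), G (x, r) -> G (y, s) -> G (a%:C *: x + y, a * r + s).
Let dominated (G : set (V * R)) := forall x r, G (x, r) -> r <= K * rnorm x.

(** The value at a new vector v must lie above every s - K |y - v| and below
every K |x + v| - r; the triangle inequality makes these constraints
compatible, and the infimum of the upper ones is a solution. *)
Lemma extension_value (G : set (V * R)) (v : V) :
  linear_graph G -> dominated G -> G (0, 0) ->
  exists a : R, forall x r (t : R), G (x, r) ->
    r + t * a <= K * rnorm (x + t%:C *: v).
Proof.
move=> linG domG G0.
have cross x r y s : G (x, r) -> G (y, s) ->
    s - K * rnorm (y - v) <= K * rnorm (x + v) - r.
  move=> Gx Gy; have := domG _ _ (linG _ _ _ _ 1 Gx Gy).
  rewrite mul1r scale1r => h.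
  suff : K * rnorm (x + y) <= K * rnorm (x + v) + K * rnorm (y - v) by lra.
  rewrite -mulrDr ler_wpM2l//.
  have -> : x + y = (x + v) + (y - v) by rewrite addrACA subrr addr0.
  exact: rnormD.
pose A := [set K * rnorm (p.1 + v) - p.2 | p in G].
have A0 : A !=set0 by exists (K * rnorm (0 + v) - 0), (0, 0).
have lbA : has_inf A.
  by split => //; exists (0 - K * rnorm (0 - v)) => _ [[x r] Gx <-]; exact: cross.
exists (inf A) => x r t Gx.
have scaled (c : R) : G (c%:C *: x, c * r).
  by have := linG _ _ _ _ c Gx G0; rewrite !addr0.
have normZ (c : R) y : 0 < c -> K * rnorm (c%:C *: y) = c * (K * rnorm y).
  by move=> c0; rewrite rnormZR ?ltW// mulrCA.
have scale_out (c : R) (y : V) : c != 0 -> c%:C *: (c^-1%:C *: y) = y.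
  by move=> c0; rewrite scalerA -rmorphM/= divff// scale1r.
have [t0|t0|<-] := ltgtP 0 t; last first.
- by rewrite mul0r addr0 scale0r addr0; exact: domG.
- have tn : 0 < - t by rewrite oppr_gt0.
  have tn0 : - t != 0 by rewrite gt_eqF.
  have -> : x + t%:C *: v = (- t)%:C *: ((- t)^-1%:C *: x - v).
    by rewrite scalerBr scale_out// rmorphN/= scaleNr opprK.
  rewrite normZ//.
  have : (- t)^-1 * r - K * rnorm ((- t)^-1%:C *: x - v) <= inf A.
    apply: lb_le_inf => // _ [[y s] Gy <-] /=.
    exact: cross Gy (scaled _).
  rewrite -(ler_pM2l tn) mulrBr [_ * (_ * r)]mulrA mulfV// mul1r; lra.
- have tn0 : t != 0 by rewrite gt_eqF.
  have -> : x + t%:C *: v = t%:C *: (t^-1%:C *: x + v).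
    by rewrite scalerDr scale_out.
  rewrite normZ//.
  have : inf A <= K * rnorm (t^-1%:C *: x + v) - t^-1 * r.
    by apply: ge_inf; [case: lbA|exists (t^-1%:C *: x, t^-1 * r) => //=].
  rewrite -(ler_pM2l t0) mulrBr [_ * (_ * r)]mulrA mulfV// mul1r; lra.
Qed.

Lemma real_hahn_banach (G : set (V * R)) :
  linear_graph G -> dominated G -> G (0, 0) ->
  exists u : V -> R,
    [/\ forall (a : R) x y, u (a%:C *: x + y) = a * u x + u y,
        forall x, u x <= K * rnorm x &
        forall x r, G (x, r) -> u x = r].
Proof.
move=> linG domG G0.
(* The empty graph has to satisfy P, because the union of an empty chain does;
   hence the inclusion of G is required of nonempty graphs only. *)
pose P (H : set (V * R)) := [/\ linear_graph H, dominated H &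
  H !=set0 -> G `<=` H].
have [F FP totF|M [[linM domM GM] maxM]] := Zorn_bigcup (P := P).
  split.
  - move=> x y r s a [H FH Hx] [H' FH' Hy].
    have [sub|sub] := totF _ _ FH FH'.
      by exists H' => //; have [lin _ _] := FP _ FH'; apply: lin => //; exact: sub.
    by exists H => //; have [lin _ _] := FP _ FH; apply: lin => //; exact: sub.
  - by move=> x r [H FH Hx]; have [_ dom _] := FP _ FH; exact: dom Hx.
  - move=> [p [H FH Hp]] q Gq; exists H => //; have [_ _ GH] := FP _ FH.
    by apply: GH Gq; exists p.
have M0 : M !=set0.
  apply: contrapT => Me; apply: (maxM G); last by split=> // _; exact: subset_refl.
  split=> [p Mp|]; first by case: Me; exists p.
  by apply: contra_not Me => GM'; exists (0, 0); exact: GM'.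
have {}GM := GM M0; have M00 := GM _ G0.
have MN x r : M (x, r) -> M (- x, - r).
  by move=> /(linM _ _ _ _ (-1)) /(_ M00); rewrite !addr0 rmorphN1 scaleN1r mulN1r.
have MD x r y s : M (x, r) -> M (y, s) -> M (x + y, r + s).
  by move=> /(linM _ _ _ _ 1) h /h; rewrite rmorph1 scale1r mul1r.
have Muniq x r s : M (x, r) -> M (x, s) -> r = s.
  move=> Mr Ms; apply/eqP; rewrite eq_le.
  have := domM _ _ (MD _ _ _ _ Mr (MN _ _ Ms)).
  have := domM _ _ (MD _ _ _ _ Ms (MN _ _ Mr)).
  by rewrite !subrr rnorm0 mulr0 !subr_le0 => -> ->.
have Mtot v : exists r, M (v, r).
  apply: contrapT => nv.
  have [a aP] := extension_value v linM domM M00.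
  pose M' := [set p : V * R | exists x r (t : R),
    [/\ M (x, r), p.1 = x + t%:C *: v & p.2 = r + t * a]].
  have MM' : M `<=` M'.
    move=> [x r] Mx; exists x, r, 0; split => //=.
      by rewrite scale0r addr0.
    by rewrite mul0r addr0.
  apply: (maxM M').
    split => // /(_ (v, a)) h; apply: nv; exists a; apply: h.
    exists 0, 0, 1; split => //=; first by rewrite scale1r add0r.
    by rewrite mul1r add0r.
  split; last by move=> _; exact: subset_trans MM'.
    move=> _ _ _ _ b [x [r [t [Mx /= -> ->]]]] [y [s [t' [My /= -> ->]]]].
    exists (b%:C *: x + y), (b * r + s), (b * t + t'); split => /=.
    - exact: linM.
    - by rewrite scalerDr scalerA addrACA -scalerDl rmorphD rmorphM.
    - ring.
  by move=> _ _ [x [r [t [Mx /= -> ->]]]]; exact: aP.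
have [u uM] := choice Mtot.
exists u; split.
- by move=> a x y; apply: (Muniq (a%:C *: x + y)) => //; exact: linM.
- by move=> x; exact: domM.
- by move=> x r Gx; apply: (Muniq x) => //; exact: GM.
Qed.
End RealHahnBanach.

Section HahnBanach.
Local Open Scope classical_set_scope.
Local Open Scope complex_scope.
Context {R : realType} {V : normedModType R[i]}.

(** The prescribed values are given as a graph, so that no well-defined partial
function has to be extracted first. The real part of the prescribed values is
extended to u, and the extension is u(x) - i u(i x). *)
Lemma hahn_banach_graph (K : R) (G : V -> R[i] -> Prop) : 0 <= K ->
  G 0 0 ->
  (forall x y a b c, G x a -> G y b -> G (c *: x + y) (c * a + b)) ->
  (forall x a, G x a -> complex.Re `|a| <= K * rnorm x) ->
  exists f : dual V,
    (forall x a, G x a -> f x = a) /\ forall x, rnorm (f x) <= K * rnorm x.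
Proof.
move=> K0 G0 linG domG.
pose GR := [set p : V * R | exists2 a, G p.1 a & p.2 = complex.Re a].
have Re_le (a : R[i]) : complex.Re a <= complex.Re `|a|.
  by rewrite -lecR Re_normE (le_trans _ (normc_ge_Re a))// lecR ler_norm.
have ReZ (b : R) (a : R[i]) : complex.Re (b%:C * a) = b * complex.Re a.
  by case: a => a1 a2 /=; rewrite mul0r subr0.
have [|||u [linu domu uG]] := real_hahn_banach K0 (G := GR).
- move=> x y r s b [a Gx /= ->] [a' Gy /= ->]; exists (b%:C * a + a') => /=.
    exact: linG.
  by rewrite raddfD /= ReZ.
- by move=> x r [a Gx /= ->]; exact: le_trans (Re_le a) (domG _ _ Gx).
- by exists 0.
have uD x y : u (x + y) = u x + u y.
  by have := linu 1 x y; rewrite rmorph1 scale1r mul1r.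
have u0 := additive0 uD; have uN := additiveN uD.
have uZ (b : R) x : u (b%:C *: x) = b * u x.
  by have := linu b x 0; rewrite !addr0 u0 addr0.
pose f x : R[i]^o := u x +i* - u ('i *: x).
have fD x y : f (x + y) = f x + f y.
  by rewrite /f scalerDr !uD opprD.
have fi x : f ('i *: x) = 'i * f x.
  by rewrite /f scalerA -expr2 sqr_i scaleN1r uN opprK; simpc.
have fZ (b : R) x : f (b%:C *: x) = b%:C * f x.
  by rewrite /f scalerA mulrC -scalerA !uZ; simpc.
have linf : linear f.
  move=> a x y; rewrite fD; congr (_ + _).
  by rewrite [a]complexE scalerDl -scalerA fD fi !fZ /= mulrA -mulrDl.
have domf x : rnorm (f x) <= K * rnorm x.
  have [fx0|fx0] := eqVneq (f x) 0.
    by rewrite fx0 rnorm0 mulr_ge0// rnorm_ge0.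
  (* Rotating x makes f real there, and u dominates the real part. *)
  pose c : R[i] := `|f x| / f x.
  have nc : `|c| = 1 by rewrite normrM normfV normr_id divff// normr_eq0.
  have fc : f (c *: x) = `|f x|.
    have := linf c x 0.
    have -> : f 0 = 0 by rewrite /f scaler0 u0 oppr0.
    by rewrite !addr0 => ->; exact: (divfK fx0).
  have := domu (c *: x); rewrite rnormZ nc mul1r.
  by have -> : u (c *: x) = rnorm (f x) by rewrite /rnorm -fc.
have bf : bounded_linear f by split => //; exists K.
exists (mk_bop bf); split => // x a Gx /=.
have Gix : G ('i *: x) ('i * a).
  by have := linG x 0 a 0 'i Gx G0; rewrite !addr0.
rewrite /f (uG x (complex.Re a)); last by exists a.
rewrite (uG ('i *: x) (complex.Re ('i * a))); last by exists ('i * a).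
by case: {Gx Gix} a => a b; simpc.
Qed.

Lemma norming_functional (x : V) : x != 0 ->
  exists f : dual V, f x = (rnorm x)%:C /\ forall y, rnorm (f y) <= rnorm y.
Proof.
move=> x0.
have [||a _ [c -> ->]|f [fG fb]] := hahn_banach_graph ler01
  (G := fun y a => exists2 c, y = c *: x & a = c * (rnorm x)%:C).
- by exists 0; rewrite ?scale0r ?mul0r.
- move=> _ _ _ _ c [a -> ->] [b -> ->]; exists (c * a + b).
    by rewrite scalerDl scalerA.
  by rewrite mulrDl mulrA.
- by rewrite mul1r rnormZ normrM rnormE normr_id -rnormE -Re_normE -rmorphM.
exists f; split=> [|y]; last by rewrite (le_trans (fb y))// mul1r.
by apply: fG; exists 1; rewrite ?scale1r ?mul1r.
Qed.

Lemma separating_functional (x : V) : x != 0 -> exists f : dual V, f x = 1.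
Proof.
move=> x0; have [f [fx _]] := norming_functional x0.
have fx0 : f x != 0.
  rewrite fx; apply: contra x0 => /eqP; rewrite -[0]/(0%:C).
  by move=> /(@complexI R) /rnorm0_eq0 ->.
exists ((f x)^-1 *: f : dual V).
by rewrite bopZE; exact: mulVf.
Qed.

Lemma functional_eq1_neq0 (f : dual V) (x : V) : f x = 1 -> x != 0 /\ f != 0.
Proof.
move=> fx; split; apply/eqP => e0; move/eqP: fx; rewrite e0 ?raddf0 eq_sym;
  apply/negP; exact: oner_neq0.
Qed.
End HahnBanach.

(** * Bounded operators and rank one operators *)

Section Operators.
Local Open Scope complex_scope.
Context {R : realType}.
Implicit Types V W Z : normedModType R[i].

Lemma rnormN V (x : V) : rnorm (- x) = rnorm x.
Proof. by rewrite /rnorm normrN. Qed.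

Lemma rnormB V (x y : V) : rnorm (x - y) = rnorm (y - x).
Proof. by rewrite -rnormN opprB. Qed.

Lemma rnorm_eq0 V (x : V) : (rnorm x == 0) = (x == 0).
Proof.
by apply/eqP/eqP => [|->]; [exact: rnorm0_eq0|exact: rnorm0].
Qed.

Lemma rnorm_gt0 V (x : V) : (0 < rnorm x) = (x != 0).
Proof. by rewrite lt_neqAle rnorm_ge0 andbT eq_sym rnorm_eq0. Qed.

Lemma rnormM (a b : R[i]^o) : rnorm (a * b : R[i]^o) = rnorm a * rnorm b.
Proof. exact: (@rnormZ R R[i]^o). Qed.

Lemma rnormZE V (a : R[i]) (x : V) :
  rnorm (a *: x) = rnorm (a : R[i]^o) * rnorm x.
Proof. exact: rnormZ. Qed.

Lemma rnormC (a : R) : rnorm (a%:C : R[i]^o) = `|a|.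
Proof. by rewrite /rnorm normc_def /= expr0n addr0 sqrtr_sqr. Qed.

Lemma normalize V (x : V) : x != 0 -> rnorm ((rnorm x)^-1%:C *: x) = 1.
Proof.
by move=> x0; rewrite rnormZR ?invr_ge0 ?rnorm_ge0// mulVf// rnorm_eq0.
Qed.

Lemma appD V W (T : bop V W) x y : T (x + y) = T x + T y.
Proof. exact: raddfD. Qed.

Lemma appB V W (T : bop V W) x y : T (x - y) = T x - T y.
Proof. exact: raddfB. Qed.

Lemma appN V W (T : bop V W) x : T (- x) = - T x.
Proof. exact: raddfN. Qed.

Lemma app0 V W (T : bop V W) : T 0 = 0.
Proof. exact: raddf0. Qed.

Lemma appZ V W (T : bop V W) (a : R[i]) x : T (a *: x) = a *: T x.
Proof. exact: linearZ. Qed.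

Lemma dualZ V (f : dual V) (a : R[i]) x : f (a *: x) = a * (f x : R[i]).
Proof. exact: linearZ. Qed.

Definition idop Z : 'B(Z).
Proof.
by apply: (@mk_bop _ _ _ idfun); split => //; exists 1 => x; rewrite mul1r.
Defined.

Lemma idopE Z (x : Z) : idop Z x = x.
Proof. by []. Qed.

Lemma bopBE V W (S T : bop V W) x : (S - T) x = S x - T x.
Proof. by []. Qed.

Lemma bopNE V W (S : bop V W) x : (- S) x = - S x.
Proof. by []. Qed.

Lemma compop_subproof V W Z (S : bop W Z) (T : bop V W) :
  bounded_linear (S \o T).
Proof.
split=> [a x y|]; first by rewrite /= !(appD, appZ).
exists (opnorm S * opnorm T) => x; rewrite (le_trans (opnormP S _))//.
by rewrite -mulrA ler_wpM2l ?opnorm_ge0// opnormP.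
Qed.

Definition compop V W Z (S : bop W Z) (T : bop V W) : bop V Z :=
  mk_bop (compop_subproof S T).

Lemma compopE V W Z (S : bop W Z) (T : bop V W) x : compop S T x = S (T x).
Proof. by []. Qed.

Lemma rank1_subproof V W (x : W) (f : dual V) :
  bounded_linear (fun y => (f y : R[i]) *: x).
Proof.
split=> [a y z|]; first by rewrite appD dualZ scalerDl -scalerA.
exists (opnorm f * rnorm x) => y; rewrite rnormZE mulrAC.
by rewrite ler_wpM2r ?rnorm_ge0// opnormP.
Qed.

Definition rank1 V W (x : W) (f : dual V) : bop V W :=
  mk_bop (rank1_subproof x f).

Lemma rank1E V W (x : W) (f : dual V) y : rank1 x f y = (f y : R[i]) *: x.
Proof. by []. Qed.

Lemma rank1Dl V W (x x' : W) (f : dual V) :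
  rank1 (x + x') f = rank1 x f + rank1 x' f.
Proof. by apply: bop_ext => y; rewrite bopDE !rank1E scalerDr. Qed.

Lemma rank1Dr V W (x : W) (f f' : dual V) :
  rank1 x (f + f') = rank1 x f + rank1 x f'.
Proof. by apply: bop_ext => y; rewrite bopDE !rank1E bopDE scalerDl. Qed.

Lemma rank1Zl V W (a : R[i]) (x : W) (f : dual V) :
  rank1 (a *: x) f = a *: rank1 x f.
Proof. by apply: bop_ext => y; rewrite bopZE !rank1E !scalerA mulrC. Qed.

Lemma rank1Zr V W (a : R[i]) (x : W) (f : dual V) :
  rank1 x (a *: f) = a *: rank1 x f.
Proof. by apply: bop_ext => y; rewrite bopZE !rank1E bopZE scalerA. Qed.

Lemma rank10l V W (f : dual V) : rank1 (0 : W) f = 0.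
Proof. by apply: bop_ext => y; rewrite rank1E scaler0. Qed.

Lemma rank10r V W (x : W) : rank1 x (0 : dual V) = 0.
Proof. by apply: bop_ext => y; rewrite rank1E scale0r. Qed.

Lemma functional_neq0 V (f : dual V) : f != 0 -> exists x, f x = 1.
Proof.
move=> f0; have [x fx] : exists x, f x != 0.
  apply: contrapT => nf; case/eqP: f0; apply: bop_ext => x.
  by apply/eqP; apply: contrapT => fx; apply: nf; exists x; exact/negP.
by exists ((f x)^-1 *: x); rewrite dualZ; exact: mulVf.
Qed.

Lemma rank1_eq0 V W (x : W) (f : dual V) :
  (rank1 x f == 0) = (x == 0) || (f == 0).
Proof.
apply/idP/idP => [/eqP xf0|/orP[/eqP->|/eqP->]]; last 2 first.
- by rewrite rank10l.
- by rewrite rank10r.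
have [_|f0/=] := eqVneq f 0; first by rewrite orbT.
rewrite orbF.
have [y fy] := functional_neq0 f0.
by have := congr1 (fun T : bop V W => T y) xf0; rewrite rank1E fy scale1r => ->.
Qed.

Lemma rank1_injl V W (g : dual V) (y y' : W) :
  g != 0 -> rank1 y g = rank1 y' g -> y = y'.
Proof.
move=> /functional_neq0[z gz] /(congr1 (fun T : bop V W => T z)).
by rewrite !rank1E gz !scale1r.
Qed.

Lemma rank1_injr V W (g g' : dual V) (y : W) :
  y != 0 -> rank1 y g = rank1 y g' -> g = g'.
Proof.
move=> /separating_functional[h hy] e; apply: bop_ext => z.
have := congr1 (fun T : bop V W => h (T z)) e.
by rewrite !rank1E !dualZ hy !mulr1.
Qed.

Lemma opnorm_rank1 V W (x : W) (f : dual V) :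
  opnorm (rank1 x f) = rnorm x * opnorm f.
Proof.
apply/eqP; rewrite eq_le; apply/andP; split.
  apply: opnorm_le => y y1; rewrite rank1E rnormZE mulrC.
  by rewrite ler_wpM2l ?rnorm_ge0// opnorm_ub.
have [->|x0] := eqVneq x 0; first by rewrite rnorm0 mul0r opnorm_ge0.
rewrite mulrC -ler_pdivlMr ?rnorm_gt0//; apply: opnorm_le => y y1.
by rewrite ler_pdivlMr ?rnorm_gt0// -rnormZE -rank1E opnorm_ub.
Qed.

Definition bounded_below V W (T : bop V W) :=
  exists2 c : R, 0 < c & forall x, c * rnorm x <= rnorm (T x).

(** Surjectivity with a linear bound on preimages, which is what a positive
surjectivity modulus expresses. *)
Definition bounded_onto V W (T : bop V W) :=
  exists2 K : R, 0 < K &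
    forall y, exists2 x, T x = y & rnorm x <= K * rnorm y.

Definition semi_invertible V W (T : bop V W) :=
  bounded_below T \/ bounded_onto T.

Lemma bounded_below_comp V W Z (S : bop W Z) (T : bop V W) :
  bounded_below S -> bounded_below T -> bounded_below (compop S T).
Proof.
move=> [c c0 cS] [d d0 dT]; exists (c * d); rewrite ?mulr_gt0// => x /=.
by rewrite (le_trans _ (cS _))// -mulrA ler_pM2l.
Qed.

Lemma bounded_onto_comp V W Z (S : bop W Z) (T : bop V W) :
  bounded_onto S -> bounded_onto T -> bounded_onto (compop S T).
Proof.
move=> [c c0 cS] [d d0 dT]; exists (c * d); rewrite ?mulr_gt0// => z /=.
have [y Sy yz] := cS z; have [x Tx xy] := dT y.
exists x; first by rewrite Tx.
by rewrite (le_trans xy)// [c * d]mulrC -mulrA ler_pM2l.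
Qed.

Lemma bounded_below_inj V W (T : bop V W) : bounded_below T ->
  forall x, T x = 0 -> x = 0.
Proof.
move=> [c c0 cT] x Tx0; have := cT x; rewrite Tx0 rnorm0 pmulr_rle0// => xle.
by apply: rnorm0_eq0; apply/eqP; rewrite eq_le xle rnorm_ge0.
Qed.

Definition inverses V W (T : bop V W) (S : bop W V) := cancel T S /\ cancel S T.

Lemma inverses_sym V W (T : bop V W) (S : bop W V) :
  inverses T S -> inverses S T.
Proof. by case. Qed.

Lemma opnorm_gt0_cancel V W (T : bop V W) (S : bop W V) (x : V) :
  x != 0 -> cancel T S -> 0 < opnorm S.
Proof.
move=> x0 TK; rewrite lt_neqAle opnorm_ge0 andbT eq_sym.
apply: contra x0 => /eqP S0; have := opnormP S (T x).
by rewrite TK S0 mul0r -rnorm_eq0 eq_le rnorm_ge0 andbT.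
Qed.

Lemma inverses_bounded_below V W (T : bop V W) (S : bop W V) :
  cancel T S -> bounded_below T.
Proof.
move=> TK; have [[x x0]|V0] := pselect (exists x : V, x != 0).
  have S0 := opnorm_gt0_cancel x0 TK.
  exists (opnorm S)^-1; rewrite ?invr_gt0// => z.
  by rewrite ler_pdivrMl// -{1}[z]TK opnormP.
exists 1 => // z; have -> : z = 0.
  by apply/eqP; apply: contrapT => z0; apply: V0; exists z; exact/negP.
by rewrite app0 !rnorm0 mulr0.
Qed.

Lemma inverses_bounded_onto V W (T : bop V W) (S : bop W V) :
  cancel S T -> bounded_onto T.
Proof.
move=> SK; exists (opnorm S + 1); first by rewrite ltr_wpDl// opnorm_ge0.
move=> y; exists (S y) => //; rewrite (le_trans (opnormP S y))//.
by rewrite ler_wpM2r ?rnorm_ge0// lerDl.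
Qed.

Lemma inverses_of_bounded_below V W (T : bop V W) :
  bounded_below T -> (forall y, exists x, T x = y) ->
  exists S : bop W V, inverses T S.
Proof.
move=> bT /choice[S ST].
have injT : injective T.
  move=> x y /eqP; rewrite -subr_eq0 -appB => /eqP /(bounded_below_inj bT)/eqP.
  by rewrite subr_eq0 => /eqP.
case: (bT) => c c0 cT.
have bS : bounded_linear S.
  split=> [a y z|]; first by apply: injT; rewrite appD appZ !ST.
  exists c^-1 => y; rewrite -(ler_pM2l c0) mulrA divff ?gt_eqF// mul1r.
  by rewrite -{2}[y]ST.
by exists (mk_bop bS); split=> // x; apply: injT; rewrite ST.
Qed.

Lemma inverses_of_bounded_onto V W (T : bop V W) :
  bounded_onto T -> (forall x, T x = 0 -> x = 0) ->
  exists S : bop W V, inverses T S.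
Proof.
move=> [K K0 KT] kT; apply: inverses_of_bounded_below => [|y]; last first.
  by have [x <- _] := KT y; exists x.
exists K^-1; rewrite ?invr_gt0// => x; rewrite ler_pdivrMl//.
have [x' Tx' lex'] := KT (T x).
suff -> : x = x' by rewrite Tx'.
by apply/eqP; rewrite -subr_eq0; apply/eqP/kT; rewrite appB Tx' subrr.
Qed.

End Operators.

(** * The three moduli *)

Section Moduli.
Local Open Scope classical_set_scope.
Local Open Scope complex_scope.
Context {R : realType} {Z : normedModType R[i]}.
(* In the zero space the infimum and the supremum below would be those of an
   empty and of an unbounded set. *)
Variable z0 : Z.
Hypothesis z0_neq0 : z0 != 0.
Implicit Types (T S : 'B(Z)) (c e : R).

Lemma le_min_modulus T c :
  c <= min_modulus T <-> forall z, c * rnorm z <= rnorm (T z).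
Proof.
set A := [set rnorm (T z) | z in unit_sphere Z].
have A0 : A !=set0.
  by exists (rnorm (T ((rnorm z0)^-1%:C *: z0))), ((rnorm z0)^-1%:C *: z0) => //;
    exact: normalize.
have lbA : has_lbound A by exists 0 => _ [z _ <-]; exact: rnorm_ge0.
split=> [cT z|cT]; last first.
  by apply: lb_le_inf => // _ [z z1 <-]; have := cT z; rewrite z1 mulr1.
have [->|zn0] := eqVneq z 0; first by rewrite app0 !rnorm0 mulr0.
rewrite -ler_pdivlMr ?rnorm_gt0// (le_trans cT)//.
rewrite mulrC -rnormZR ?invr_ge0 ?rnorm_ge0// -appZ.
by apply: ge_inf => //; exists ((rnorm z)^-1%:C *: z) => //; exact: normalize.
Qed.

Let surj_set T := [set e : R | 0 <= e /\
  [set e%:C *: z | z in unit_ball Z] `<=` [set T z | z in unit_ball Z]].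

Let surj_set0 T : surj_set T 0.
Proof.
split=> // _ [z _ <-]; exists 0; rewrite ?app0 ?scale0r//.
by rewrite /unit_ball /= rnorm0.
Qed.

Let surj_set_ub T : has_ubound (surj_set T).
Proof.
exists (opnorm T) => e [e0 /(_ (e%:C *: ((rnorm z0)^-1%:C *: z0)))[]].
  by eexists; last reflexivity; rewrite /unit_ball /= normalize.
move=> z z1 Tz; rewrite -[e]mulr1 -(normalize z0_neq0) -rnormZR// -Tz.
exact: opnorm_ub.
Qed.

Lemma surj_set_scale T e : surj_set T e ->
  forall y, exists2 x, T x = e%:C *: y & rnorm x <= rnorm y.
Proof.
move=> [e0 eT] y; have [->|y0] := eqVneq y 0.
  by exists 0; rewrite ?app0 ?scaler0.
have [|x x1 Tx] := eT (e%:C *: ((rnorm y)^-1%:C *: y)).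
  by eexists; last reflexivity; rewrite /unit_ball /= normalize.
have ny : rnorm y != 0 by rewrite rnorm_eq0.
exists ((rnorm y)%:C *: x).
  rewrite appZ Tx !scalerA -!rmorphM.
  by rewrite mulrAC divff// mul1r.
by rewrite rnormZR ?rnorm_ge0// ler_piMr ?rnorm_ge0.
Qed.

Lemma surj_set_of_scale T e : 0 <= e ->
  (forall y, exists2 x, T x = e%:C *: y & rnorm x <= rnorm y) -> surj_set T e.
Proof.
move=> e0 eT; split=> // _ [y y1 <-]; have [x Tx xy] := eT y.
by exists x => //; exact: le_trans xy y1.
Qed.

Lemma le_surj_modulus T e : 0 <= e ->
  (forall y, exists2 x, T x = e%:C *: y & rnorm x <= rnorm y) ->
  e <= surj_modulus T.
Proof.
by move=> e0 eT; apply: ub_le_sup; [exact: surj_set_ub|exact: surj_set_of_scale].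
Qed.

Lemma surj_modulus_le T e :
  (forall e', 0 <= e' ->
     (forall y, exists2 x, T x = e'%:C *: y & rnorm x <= rnorm y) -> e' <= e) ->
  surj_modulus T <= e.
Proof.
move=> Te; apply: ge_sup; first by exists 0; exact: surj_set0.
by move=> e' e'T; apply: Te; [case: e'T|exact: surj_set_scale].
Qed.

Lemma min_modulus_gt0 T : 0 < min_modulus T <-> bounded_below T.
Proof.
split=> [m0|[c c0 cT]].
  by exists (min_modulus T) => //; exact/le_min_modulus.
by rewrite (lt_le_trans c0)//; exact/le_min_modulus.
Qed.

Lemma surj_modulus_gt0 T : 0 < surj_modulus T <-> bounded_onto T.
Proof.
split=> [q0|[K K0 KT]]; last first.
  rewrite (@lt_le_trans _ _ K^-1) ?invr_gt0//.
  apply: le_surj_modulus => [|y]; first by rewrite invr_ge0 ltW.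
  have [x Tx xy] := KT (K^-1%:C *: y); exists x => //.
  move: xy; rewrite rnormZR; last by rewrite invr_ge0 ltW.
  by rewrite mulrA divff ?gt_eqF// mul1r.
have [e Te e0] : exists2 e, surj_set T e & 0 < e.
  apply: contrapT => ne; move: q0; rewrite ltNge; apply/negP/negPn.
  apply: ge_sup; first by exists 0; exact: surj_set0.
  move=> e eT; rewrite leNgt; apply/negP => e0; apply: ne; by exists e.
exists e^-1; rewrite ?invr_gt0// => y.
have [x Tx xy] := surj_set_scale Te (e^-1%:C *: y).
exists x; first by rewrite Tx scalerA -rmorphM divff ?gt_eqF// scale1r.
by rewrite (le_trans xy)// rnormZR// invr_ge0 ltW.
Qed.

Lemma max_modulus_gt0 T : 0 < max_modulus T <-> semi_invertible T.
Proof.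
rewrite /max_modulus lt_max; split=> [/orP[]|[]].
- by move=> /min_modulus_gt0; left.
- by move=> /surj_modulus_gt0; right.
- by move=> /min_modulus_gt0 ->.
- by move=> /surj_modulus_gt0 ->; rewrite orbT.
Qed.

Lemma max_modulus_inverses T S : inverses T S ->
  max_modulus T = (opnorm S)^-1.
Proof.
move=> [TK SK]; have S0 := opnorm_gt0_cancel z0_neq0 TK.
have m_eq : min_modulus T = (opnorm S)^-1.
  apply/eqP; rewrite eq_le; apply/andP; split; last first.
    by apply/le_min_modulus => z; rewrite ler_pdivrMl// -{1}[z]TK opnormP.
  have /le_min_modulus mT := lexx (min_modulus T).
  have [m0|m0] := leP (min_modulus T) 0.
    by rewrite (le_trans m0)// invr_ge0 ltW.
  rewrite -[leLHS]invrK lef_pV2 ?posrE ?invr_gt0//.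
  apply: opnorm_le => y y1; rewrite -[leRHS]mulr1 ler_pdivlMl//.
  by rewrite (le_trans (mT _))// SK.
rewrite /max_modulus m_eq; apply/max_idPl; apply: surj_modulus_le => e e0 eT.
have [e00|e_gt0] := leP e 0; first by rewrite (le_trans e00)// invr_ge0 ltW.
rewrite -[leLHS]invrK lef_pV2 ?posrE ?invr_gt0//.
apply: opnorm_le => y y1; have [x Tx xy] := eT y.
rewrite -[leRHS]mulr1 ler_pdivlMl// -rnormZR// -appZ -Tx TK.
exact: le_trans xy y1.
Qed.

End Moduli.

(** * Rank one perturbations *)

Section Perturbation.
Local Open Scope classical_set_scope.
Local Open Scope complex_scope.
Context {R : realType}.
Implicit Types V W Z : normedModType R[i].
Implicit Types X : completeNormedModType R[i].

Lemma complete_seq X (u : nat -> X) (c : R) :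
  (forall n m, (n <= m)%N -> rnorm (u n - u m) <= c * n.+1%:R^-1) ->
  exists l, forall e : R, 0 < e ->
    exists N, forall n, (N <= n)%N -> rnorm (l - u n) < e.
Proof.
move=> uc.
have small (e : R) : 0 < e -> exists N, forall n, (N <= n)%N -> c * n.+1%:R^-1 < e.
  move=> e0; exists (Num.bound `|c / e|) => n Nn.
  rewrite ltr_pdivrMr ?ltr0n// mulrC -ltr_pdivrMr//.
  apply: le_lt_trans (ler_norm _) _.
  by rewrite (lt_le_trans (archi_boundP (normr_ge0 _)))// ler_nat ltnW.
have /cauchy_cvgP/cvg_ex[l ul] : cauchy (u @ \oo).
  apply/cauchy_ballP => e e0; have [ie re] : complex.Im e = 0 /\ 0 < complex.Re e.
    by move: e0; rewrite ltcE => /andP[/eqP-> ->].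
  have [N NP] := small _ re.
  pose P := u @` [set n | (N <= n)%N].
  exists (P, P); first by split; exists N => // n Nn; exists n.
  move=> [_ _] [/= [n Nn <-] [m Nm <-]]; rewrite -ball_normE /= -rnormE ltcE /= ie eqxx /=.
  have [nm|/ltnW mn] := leqP n m; first exact: le_lt_trans (uc _ _ nm) (NP _ Nn).
  by rewrite rnormB; exact: le_lt_trans (uc _ _ mn) (NP _ Nm).
exists l => e e0.
have /cvgrPdist_lt/(_ e%:C) := ul; rewrite ltcR => /(_ e0)[N _ NP].
by exists N => n Nn; rewrite -ltcR rnormE; exact: NP.
Qed.

(** Otherwise A x_n tends to -u for some sequence x_n, which is Cauchy because A
is bounded below, and its limit solves the excluded equation. *)
Lemma range_distance X W (A : bop X W) (u : W) :
  bounded_below A -> ~ (exists x, A x = u) ->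
  exists2 d : R, 0 < d & forall x, d <= rnorm (A x + u).
Proof.
move=> [c c0 cA] nu; apply: contrapT => nd.
have /choice[x xP] n : exists x, rnorm (A x + u) < n.+1%:R^-1.
  apply: contrapT => nx; apply: nd; exists n.+1%:R^-1; first by rewrite invr_gt0.
  by move=> x; rewrite leNgt; apply/negP => xlt; apply: nx; exists x.
have [n m nm|l lP] := @complete_seq X x (2 / c).
  rewrite -mulrA mulrCA ler_pdivlMl// (le_trans (cA _))// appB.
  have -> : A (x n) - A (x m) = (A (x n) + u) - (A (x m) + u).
    by rewrite opprD addrACA subrr addr0.
  rewrite (le_trans (rnormD _ _))// rnormN.
  have : (m.+1%:R^-1 : R) <= n.+1%:R^-1 by rewrite lef_pV2 ?posrE ?ltr0n// ler_nat.
  by move: (xP n) (xP m); move: (n.+1%:R^-1) (m.+1%:R^-1) => a b; lra.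
apply: nu; exists (- l); apply/eqP; rewrite appN eq_sym -subr_eq0 opprK.
apply/eqP; apply: rnorm0_eq0; apply/eqP; rewrite eq_le rnorm_ge0 andbT.
rewrite leNgt; apply/negP => e0; set e := rnorm _ in e0.
have K0 : 0 < opnorm A + 1 by rewrite ltr_wpDl// opnorm_ge0.
have [N NP] := lP (e / (2 * (opnorm A + 1))) (divr_gt0 e0 (mulr_gt0 (ltr0Sn _ 1) K0)).
have [N' N'P] : exists N', forall n, (N' <= n)%N -> (n.+1%:R^-1 : R) < e / 2.
  have e20 : 0 < e / 2 by rewrite divr_gt0.
  exists (Num.bound (e / 2)^-1) => n Nn.
  rewrite -[ltRHS]invrK ltf_pV2 ?posrE ?invr_gt0//.
  have e2' : 0 <= (e / 2)^-1 by rewrite invr_ge0 ltW.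
  by rewrite (lt_le_trans (archi_boundP e2'))// ler_nat ltnW.
pose n := maxn N N'.
have h1 := NP n (leq_maxl _ _).
have h2 := lt_trans (xP n) (N'P n (leq_maxr _ _)).
have h3 : opnorm A * rnorm (l - x n) <= e / 2.
  rewrite (@le_trans _ _ ((opnorm A + 1) * rnorm (l - x n)))//.
    by rewrite ler_wpM2r ?rnorm_ge0// lerDl.
  by rewrite -ler_pdivlMl// (le_trans (ltW h1))// invfM mulrA mulrC.
suff : e <= opnorm A * rnorm (l - x n) + rnorm (A (x n) + u) by lra.
apply: le_trans (lerD (opnormP A (l - x n)) (lexx _)).
rewrite /e (le_trans _ (rnormD _ _))// appB.
by rewrite [u + _]addrC [A (x n) + u]addrC addrCA subrK addrC.
Qed.

(** The functional is prescribed on the sum of the range and the line of u; it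
is bounded there because u has a positive distance to the range. *)
Lemma range_annihilator X W (A : bop X W) (u : W) :
  bounded_below A -> ~ (exists x, A x = u) ->
  exists g : dual W, g u = 1 /\ forall x, g (A x) = 0.
Proof.
move=> bA nu; have [d d0 dA] := range_distance bA nu.
have d'0 : 0 <= d^-1 by rewrite invr_ge0 ltW.
have [||_ a [x ->]|g [gG _]] := hahn_banach_graph d'0
  (G := fun y a => exists x, y = A x + a *: u).
- by exists 0; rewrite app0 scale0r addr0.
- move=> _ _ a b c [x ->] [y ->]; exists (c *: x + y).
  by rewrite appD appZ scalerDr scalerDl scalerA addrACA.
- rewrite ler_pdivlMl//; have [->|a0] := eqVneq a 0.
    by rewrite normr0 mulr0 rnorm_ge0.
  have -> : A x + a *: u = a *: (A (a^-1 *: x) + u).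
    by rewrite scalerDr appZ scalerA divff// scale1r.
  by rewrite rnormZ mulrC ler_wpM2l// Re_norm_ge0.
exists g; split; first by apply: gG; exists 0; rewrite app0 add0r scale1r.
by move=> x; apply: gG; exists x; rewrite scale0r addr0.
Qed.

(** The functional g that vanishes on the range of A and equals 1 at u recovers
f x from the value w of the perturbed operator, hence also A x, with bounds. *)
Lemma bounded_below_perturb_out X W (A : bop X W) (u : W) (f : dual X) :
  bounded_below A -> ~ (exists x, A x = u) -> bounded_below (A + rank1 u f).
Proof.
move=> bA nu; have [g [gu gA]] := range_annihilator bA nu.
have [c c0 cA] := bA.
have K0 : 0 < 1 + rnorm u * opnorm g.
  by rewrite ltr_wpDr// mulr_ge0 ?rnorm_ge0 ?opnorm_ge0.
exists (c / (1 + rnorm u * opnorm g)); first by rewrite divr_gt0.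
(* A x = w - g(w) u, so c |x| <= |A x| <= (1 + |u| |g|) |w|. *)
move=> x; set w := (A + rank1 u f) x.
have gw : g w = f x by rewrite /w bopDE rank1E appD gA add0r dualZ gu mulr1.
have Ax : A x = w - (g w : R[i]) *: u by rewrite gw /w bopDE rank1E addrK.
rewrite mulrAC ler_pdivrMr// (le_trans (cA _))// Ax (le_trans (rnormD _ _))//.
rewrite rnormN rnormZE mulrDr mulr1 lerD2l mulrCA mulrC ler_wpM2l ?rnorm_ge0//.
by rewrite mulrC opnormP.
Qed.

(** Moving a preimage x along z to the kernel of f does not change A x and
cancels the rank one term. *)
Lemma bounded_onto_perturb_ker V W (A : bop V W) (u : W) (f : dual V) (z : V) :
  bounded_onto A -> A z = 0 -> f z = 1 -> bounded_onto (A + rank1 u f).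
Proof.
move=> [K K0 KA] Az fz.
have K'0 : 0 < 1 + opnorm f * rnorm z.
  by rewrite ltr_wpDr// mulr_ge0 ?rnorm_ge0 ?opnorm_ge0.
exists ((1 + opnorm f * rnorm z) * K); first by rewrite mulr_gt0.
move=> y; have [x Ax xy] := KA y.
exists (x - (f x : R[i]) *: z).
  by rewrite bopDE rank1E !appB appZ Az scaler0 subr0 dualZ fz mulr1 subrr scale0r addr0.
rewrite (le_trans (rnormD _ _))// rnormN rnormZE -mulrA.
rewrite (@le_trans _ _ ((1 + opnorm f * rnorm z) * rnorm x))//; last first.
  by rewrite ler_pM2l.
by rewrite mulrDl mul1r lerD2l mulrAC ler_wpM2r ?rnorm_ge0// opnormP.
Qed.

(** Such an f depends only on A x; the bound on preimages makes the induced
functional continuous. *)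
Lemma bounded_onto_factor V W (A : bop V W) (f : dual V) :
  bounded_onto A -> (forall z, A z = 0 -> f z = 0) ->
  exists h : dual W, forall x, h (A x) = f x.
Proof.
move=> [K K0 KA] fA.
have [s sP] : exists s : W -> V, forall y, A (s y) = y /\ rnorm (s y) <= K * rnorm y.
  have h y : exists x, A x = y /\ rnorm x <= K * rnorm y.
    by have [x] := KA y; exists x.
  by have [s sP] := choice h; exists s.
have fs x x' : A x = A x' -> f x = f x'.
  move=> xx'; apply/eqP; rewrite -subr_eq0 -appB; apply/eqP/fA.
  by rewrite appB xx' subrr.
have bh : bounded_linear (fun y => f (s y) : R[i]^o).
  split=> [a y y'|].
    rewrite -(appZ f) -(appD f); apply: fs.
    by rewrite appD appZ !(sP _).1.
  exists (opnorm f * K) => y; rewrite (le_trans (opnormP f _))// -mulrA.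
  by rewrite ler_wpM2l ?opnorm_ge0// (sP y).2.
by exists (mk_bop bh) => x; apply: fs; rewrite (sP _).1.
Qed.

(** The Sherman-Morrison formula. *)
Lemma inverses_id_perturb Z (z : Z) (f : dual Z) : (f z : R[i]) != -1 ->
  inverses (idop Z + rank1 z f) (idop Z - (1 + (f z : R[i]))^-1 *: rank1 z f).
Proof.
move=> fz; have d0 : 1 + (f z : R[i]) != 0 by rewrite addrC addr_eq0.
have cancel_coef (a : R[i]) : (1 + (f z : R[i]))^-1 * (a + a * (f z : R[i])) = a.
  by rewrite -{1}[a]mulr1 -mulrDr mulrCA mulVf// mulr1.
split=> x; rewrite bopBE bopDE bopZE !rank1E !idopE.
  by rewrite appD dualZ scalerA cancel_coef addrK.
rewrite scalerA appB dualZ; set b := _ * (f x : R[i]).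
have {1}-> : (f x : R[i]) = b + b * (f z : R[i]).
  by rewrite /b -mulrA -mulrDr cancel_coef.
by rewrite addrK subrK.
Qed.

(** A + rank1 (A z) f is A composed with the invertible 1 + rank1 z f. *)
Lemma bounded_below_perturb_in V W (A : bop V W) (z : V) (f : dual V) :
  (f z : R[i]) != -1 -> bounded_below A -> bounded_below (A + rank1 (A z) f).
Proof.
move=> fz bA; have [/inverses_bounded_below bI _] := inverses_id_perturb fz.
have -> : A + rank1 (A z) f = compop A (idop V + rank1 z f).
  by apply: bop_ext => x; rewrite compopE !bopDE !rank1E appD appZ.
exact: bounded_below_comp.
Qed.

(** The perturbed operator is the invertible 1 + rank1 u h composed with A. *)
Lemma bounded_onto_perturb_dual V W (A : bop V W) (u : W) (f : dual V)
    (h : dual W) : (forall x, h (A x) = f x) -> (h u : R[i]) != -1 ->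
  bounded_onto A -> bounded_onto (A + rank1 u f).
Proof.
move=> hA hu bA; have [_ /inverses_bounded_onto bI] := inverses_id_perturb hu.
have -> : A + rank1 u f = compop (idop W + rank1 u h) A.
  by apply: bop_ext => x; rewrite compopE !bopDE !rank1E hA.
exact: bounded_onto_comp.
Qed.

Lemma not_semi_invertible V W (T : bop V W) (x : V) (f : dual W) :
  x != 0 -> T x = 0 -> f != 0 -> (forall x, f (T x) = 0) ->
  ~ semi_invertible T.
Proof.
move=> x0 Tx f0 fT [bT|[K K0 KT]].
  by move/eqP: x0; apply; exact: bounded_below_inj Tx.
have [y fy] := functional_neq0 f0; have [z Tz _] := KT y.
have := fT z; rewrite Tz fy => /eqP; apply/negP; exact: oner_neq0.
Qed.

(** In the exceptional case both defects appear at once: the kernel contains A'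
u and the range is annihilated by the composite of A' and f. *)
Lemma semi_invertible_perturb V W (A : bop V W) (A' : bop W V) (u : W)
    (f : dual V) : inverses A A' ->
  semi_invertible (A + rank1 u f) <-> (f (A' u) : R[i]) != -1.
Proof.
move=> [AK A'K]; split=> [sA|fu]; last first.
  left; rewrite -[u]A'K; apply: bounded_below_perturb_in => //.
  exact: inverses_bounded_below AK.
apply/eqP => fu.
have f0 : f (A' u) != 0 :> R[i] by rewrite fu oppr_eq0 oner_neq0.
apply: (@not_semi_invertible _ _ _ (A' u) (compop f A') _ _ _ _ sA).
- by apply: contra f0 => /eqP ->; rewrite app0.
- by rewrite bopDE rank1E A'K fu scaleN1r subrr.
- apply: contra f0 => /eqP g0.
  by have := congr1 (fun g : dual W => g u) g0; rewrite compopE => ->.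
- move=> x; rewrite compopE bopDE rank1E (appD A') (appZ A') AK (appD f).
  by rewrite dualZ fu mulrN1 subrr.
Qed.
End Perturbation.

(** * Detecting rank one by semi-invertibility *)

Section RankOneCharacterization.
Local Open Scope complex_scope.
Context {R : realType}.
Implicit Types V W Z : normedModType R[i].
Implicit Types X : completeNormedModType R[i].

Lemma inverses_comp V W Z (S : bop W Z) (S' : bop Z W) (T : bop V W)
    (T' : bop W V) :
  inverses S S' -> inverses T T' -> inverses (compop S T) (compop T' S').
Proof. by move=> [SK S'K] [TK T'K]; split=> x; rewrite !compopE ?SK ?TK ?T'K. Qed.

Lemma inverses_scale Z (a : R[i]) : a != 0 ->
  inverses (a *: idop Z) (a^-1 *: idop Z).
Proof.
by move=> a0; split=> x; rewrite !bopZE !idopE scalerA ?mulVf ?divff// scale1r.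
Qed.

Lemma inverses_perturb V W (A : bop V W) (A' : bop W V) (u : W) (f : dual V) :
  inverses A A' -> (f (A' u) : R[i]) != -1 ->
  exists S, inverses (A + rank1 u f) S.
Proof.
move=> AA' fu; eexists.
have -> : A + rank1 u f = compop A (idop V + rank1 (A' u) f).
  by apply: bop_ext => x; rewrite compopE !bopDE !rank1E appD appZ AA'.2.
exact: inverses_comp AA' (inverses_id_perturb fu).
Qed.

(** T - c is bounded below. If its range missed a vector, a nonzero functional g
would vanish on the range, that is, c g would be the composite of g with T,
which is excluded by the norms. *)
Lemma neumann X (T : 'B(X)) (c : R[i]) : opnorm T < rnorm (c : R[i]^o) ->
  exists S, inverses (T - c *: idop X) S.
Proof.
move=> Tc; set A := T - c *: idop X.
have AE x : A x = T x - c *: x by [].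
have bA : bounded_below A.
  exists (rnorm (c : R[i]^o) - opnorm T); first by rewrite subr_gt0.
  move=> x; rewrite mulrBl lerBlDr -rnormZE.
  have -> : c *: x = - A x + T x by rewrite AE opprB subrK.
  by rewrite (le_trans (rnormD _ _))// rnormN lerD2l opnormP.
apply: inverses_of_bounded_below => // y; apply: contrapT => ny.
have [g [gy gA]] := range_annihilator bA ny.
have g0 : g != 0.
  by have [_] := functional_eq1_neq0 gy.
have ng : 0 < opnorm g by rewrite -bop_rnormE rnorm_gt0.
have : rnorm (c : R[i]^o) * opnorm g <= opnorm T * opnorm g.
  rewrite mulrC -ler_pdivlMr ?(le_lt_trans (opnorm_ge0 T) Tc)//.
  apply: opnorm_le => x x1; rewrite ler_pdivlMr ?(le_lt_trans (opnorm_ge0 T) Tc)//.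
  rewrite mulrC -rnormM -dualZ.
  have -> : g (c *: x) = g (T x).
    by have := gA x; rewrite AE appB => /eqP; rewrite subr_eq0 => /eqP.
  rewrite (le_trans (opnormP g _))// mulrC ler_wpM2r ?opnorm_ge0//.
  exact: opnorm_ub.
by rewrite ler_pM2r// leNgt Tc.
Qed.

Lemma avoid_two (a b : R[i]) : exists l : R[i], [/\ l != 0, l != a & l != b].
Proof.
have n2 : (2 : R[i]) != 1 by rewrite pnatr_eq1.
have n3 : (3 : R[i]) != 1 by rewrite pnatr_eq1.
have n32 : (3 : R[i]) != 2 by rewrite eqr_nat.
have [a1|a1] := eqVneq 1 a; have [b1|b1] := eqVneq 1 b.
- by exists 2; rewrite -a1 -b1 pnatr_eq0.
- have [b2|b2] := eqVneq 2 b.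
    by exists 3; rewrite -a1 -b2 pnatr_eq0.
  by exists 2; rewrite -a1 pnatr_eq0.
- have [a2|a2] := eqVneq 2 a.
    by exists 3; rewrite -a2 -b1 pnatr_eq0.
  by exists 2; rewrite -b1 pnatr_eq0.
- by exists 1; rewrite oner_neq0.
Qed.

(** The value of A at x and the composite of f with A are prescribed. The
operator is l + rank1 u h with u = y - l x and h proportional to g - l f. The
scalar l must differ from 0 and g y for invertibility, and from 1 / f x for h
to exist. The last two conclusions say that A acts as l on the vectors and
functionals that do not see x, y, f, g, so that two such operators can be
composed without interfering. *)
Lemma rank_one_transitivity Z (x y : Z) (f g : dual Z) : f y = 1 -> g x = 1 ->
  exists (l : R[i]) (A A' : 'B(Z)), l != 0 /\ inverses A A' /\
    [/\ A x = y, forall z, f (A z) = g z,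
        forall z, f z = 0 -> g z = 0 -> A z = l *: z &
        forall h : dual Z, h x = 0 -> h y = 0 ->
          forall z, h (A z) = l * (h z : R[i])].
Proof.
move=> fy gx; have [l [l0 lgy lfx]] := avoid_two (g y) (f x)^-1.
pose d : R[i] := 1 - l * (f x : R[i]).
have d0 : d != 0.
  rewrite subr_eq0; apply: contra lfx => /eqP e1; apply/eqP.
  have fx0 : (f x : R[i]) != 0.
    apply/eqP => fx0; move/eqP: e1; rewrite fx0 mulr0; apply/negP.
    exact: oner_neq0.
  by apply: (mulIf fx0); rewrite mulVf.
pose h : dual Z := d^-1 *: (g - l *: f).
have hE z : h z = d^-1 * ((g z : R[i]) - l * (f z : R[i])) by [].
have hu : (h (l^-1 *: idop Z (y - l *: x)) : R[i]) != -1.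
  rewrite idopE dualZ hE !appB !dualZ.
  rewrite fy gx mulr1 -/d; apply: contra lgy => /eqP e1.
  have e2 : d^-1 * ((g y : R[i]) - l - l * d) = - l.
    by rewrite -[LHS](mulVKf l0) e1 mulrN1.
  have : (g y : R[i]) - l - l * d = - (l * d).
    by rewrite -[LHS](mulVKf d0) e2 mulrN mulrC.
  by move/eqP; rewrite -subr_eq0 opprK subrK subr_eq0 eq_sym.
have [A' AA'] := inverses_perturb (inverses_scale Z l0) hu.
exists l, (l *: idop Z + rank1 (y - l *: x) h), A'; split=> //; split=> //.
have fu : f (y - l *: x) = d by rewrite appB fy appZ.
have AE z : (l *: idop Z + rank1 (y - l *: x) h) z =
    l *: z + (h z : R[i]) *: (y - l *: x) by [].
split=> [|z|z fz gz|k kx ky z]; rewrite AE.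
- by rewrite hE gx -/d mulVf// scale1r addrC subrK.
- by rewrite appD !dualZ fu hE mulrAC mulVf// mul1r addrC subrK.
- by rewrite hE fz gz mulr0 subr0 mulr0 scale0r addr0.
- by rewrite appD !dualZ appB dualZ kx ky mulr0 subr0 mulr0 addr0.
Qed.

(** The invertible A agrees with -T at x and after composition with f, so x is
in the kernel of A + T and f annihilates its range. *)
Lemma one_defect Z (T : 'B(Z)) (x : Z) (f : dual Z) : f (T x) = 1 ->
  exists A A' : 'B(Z), inverses A A' /\ ~ semi_invertible (A + T).
Proof.
move=> fTx; have [l [A [A' [l0 [[AK A'K] [Ax fA _ _]]]]]] :=
  @rank_one_transitivity Z x (T x) f (compop f T) fTx fTx.
exists (- A), (- A'); split.
  by split=> z; rewrite !bopNE appN opprK.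
have [x0 _] := functional_eq1_neq0 (f := compop f T) fTx.
have [_ f0] := functional_eq1_neq0 fTx.
apply: (not_semi_invertible x0 _ f0) => [|z].
  by rewrite bopDE bopNE Ax addNr.
by rewrite bopDE bopNE appD appN fA compopE addNr.
Qed.

(** The operator is A = A1 A2 E1 E2. Here A1 sends x1 to T x1 and turns f1 into
f1 T; A2 does the same for x2 and f2, seen through A1, and scales x1 and f1 T
by l. The factors E1 and E2 are diagonal on x1 and x2 and the identity on the
common kernel of f1 T and f2 T: E1 multiplies x1 by -1/l and E2 multiplies x2
by -2. So A agrees with -T for x1 and f1, and with -2T for x2 and f2. *)
Lemma two_defects Z (T : 'B(Z)) (x1 x2 : Z) (f1 f2 : dual Z) :
  f1 (T x1) = 1 -> f1 (T x2) = 0 -> f2 (T x1) = 0 -> f2 (T x2) = 1 ->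
  exists A A' : 'B(Z), [/\ inverses A A', ~ semi_invertible (A + T) &
    ~ semi_invertible (A + T + T)].
Proof.
move=> f11 f12 f21 f22.
have [_ [A1 [B1 [_ [[A1K B1K] [A1x fA1 _ _]]]]]] :=
  @rank_one_transitivity Z x1 (T x1) f1 (compop f1 T) f11 f11.
have [|l [A2 [B2 [l0 [i2 [A2x fA2 A2z A2h]]]]]] :=
  @rank_one_transitivity Z x2 (B1 (T x2)) (compop f2 A1) (compop f2 T) _ f22.
  by rewrite compopE B1K.
pose g1 : dual Z := compop f1 T; pose g2 : dual Z := compop f2 T.
pose E1 := idop Z + rank1 ((- l^-1 - 1) *: x1) g1.
pose E2 := idop Z + rank1 ((-3) *: x2) g2.
have g11 : g1 x1 = 1 by []. have g12 : g1 x2 = 0 by [].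
have g21 : g2 x1 = 0 by []. have g22 : g2 x2 = 1 by [].
have [E1' iE1] : exists E1', inverses E1 E1'.
  eexists; apply: inverses_id_perturb; rewrite dualZ g11 mulr1.
  by rewrite subr_eq addNr oppr_eq0 invr_eq0.
have [E2' iE2] : exists E2', inverses E2 E2'.
  eexists; apply: inverses_id_perturb; rewrite dualZ g22 mulr1.
  by rewrite eqr_opp pnatr_eq1.
exists (compop A1 (compop A2 (compop E1 E2))).
exists (compop (compop (compop E2' E1') B2) B1).
have E1E z : E1 z = z + (g1 z : R[i]) *: ((- l^-1 - 1) *: x1) by [].
have E2E z : E2 z = z + (g2 z : R[i]) *: ((-3) *: x2) by [].
have E2x1 : E2 x1 = x1 by rewrite E2E g21 scale0r addr0.
have E2x2 : E2 x2 = (-2) *: x2.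
  by rewrite E2E g22 scale1r -{1}[x2]scale1r -scalerDl; congr (_ *: _); ring.
have E1x1 : E1 x1 = (- l^-1) *: x1.
  by rewrite E1E g11 scale1r -{1}[x1]scale1r -scalerDl addrC subrK.
have E1x2 : E1 x2 = x2 by rewrite E1E g12 scale0r addr0.
have gE1 z : g1 (E1 z) = - l^-1 * (g1 z : R[i]).
  rewrite E1E appD !dualZ g11; ring.
have gE2 z : g2 (E2 z) = -2 * (g2 z : R[i]).
  rewrite E2E appD !dualZ g22; ring.
have g1E2 z : g1 (E2 z) = g1 z.
  by rewrite E2E appD !dualZ g12 !mulr0 addr0.
have g2E1 z : g2 (E1 z) = g2 z.
  by rewrite E1E appD !dualZ g21 !mulr0 addr0.
have [[x10 _] [x20 _]] := (functional_eq1_neq0 g11, functional_eq1_neq0 g22).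
have [[_ f10] [_ f20]] := (functional_eq1_neq0 f11, functional_eq1_neq0 f22).
split.
- do 2![apply: inverses_comp => //].
  exact: inverses_comp.
- apply: (@not_semi_invertible _ _ _ _ x1 f1) => // [|z].
    rewrite bopDE !compopE E2x1 E1x1 appZ A2z ?compopE ?A1x// scalerA mulNr.
    by rewrite mulVf// scaleN1r appN A1x addNr.
  rewrite bopDE !compopE appD fA1 -/g1 A2h//; last by rewrite -[LHS]fA1 B1K.
  by rewrite gE1 g1E2 mulrA mulrN divff// mulN1r addNr.
- apply: (@not_semi_invertible _ _ _ _ x2 f2) => // [|z].
    rewrite !bopDE !compopE E2x2 appZ E1x2 !appZ A2x B1K.
    by rewrite scaleNr scaler_nat mulr2n -addrA addNr.
  have f2A w : f2 (A1 (A2 w)) = g2 w by exact: fA2.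
  rewrite 2!bopDE 3!compopE 2!(appD f2) f2A g2E1 gE2 -[f2 (T z)]/(g2 z).
  by ring.
Qed.

Definition rank_le1 V W (T : bop V W) := exists x f, T = rank1 x f.

(** If f1 (T x1) = 1 and T has rank at least two, some T x is not a multiple of
T x1; Gram-Schmidt on both sides then gives the biorthogonal pairs. *)
Lemma rank_ge2 V W (T : bop V W) : ~ rank_le1 T ->
  exists (x1 x2 : V) (f1 f2 : dual W),
    [/\ f1 (T x1) = 1, f1 (T x2) = 0, f2 (T x1) = 0 & f2 (T x2) = 1].
Proof.
move=> nT; have [x1 Tx1] : exists x, T x != 0.
  apply: contrapT => n; apply: nT; exists 0, 0; apply: bop_ext => x.
  rewrite rank10l; apply/eqP; apply: contrapT => Tx; apply: n.
  by exists x; exact/negP.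
have [f1 f1x] := separating_functional Tx1.
have [x Tx] : exists x, T x - (f1 (T x) : R[i]) *: T x1 != 0.
  apply: contrapT => n; apply: nT; exists (T x1), (compop f1 T).
  apply: bop_ext => x; rewrite rank1E compopE; apply/eqP.
  by rewrite -subr_eq0; apply: contrapT => Tx; apply: n; exists x; exact/negP.
pose x2 := x - (f1 (T x) : R[i]) *: x1.
have Tx2 : T x2 = T x - (f1 (T x) : R[i]) *: T x1 by rewrite appB appZ.
have f1x2 : f1 (T x2) = 0 by rewrite Tx2 appB dualZ f1x mulr1 subrr.
move: Tx; rewrite -Tx2 => /separating_functional[f2 f2x].
exists x1, x2, f1, (f2 - (f2 (T x1) : R[i]) *: f1); split=> //.
  rewrite bopBE bopZE f1x; apply/eqP; rewrite subr_eq0; apply/eqP.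
  by symmetry; exact: mulr1.
by rewrite bopBE bopZE f1x2 scaler0 subr0.
Qed.

(** Multiples of rank1 u f spoil a semi-invertible A only through the equation 1
+ a c = 0, where c is f at the preimage of u, or the value at u of the
functional through which f factors; it cannot hold for both a = 1 and a = 2. *)
Lemma rank_le1_semi X W (A T : bop X W) : rank_le1 T ->
  semi_invertible A -> semi_invertible (A + T) \/ semi_invertible (A + T + T).
Proof.
move=> [u [f ->]]; rewrite -addrA -rank1Dl.
have n21 : (2 : R[i]) != 1 by rewrite pnatr_eq1.
have two (a : R[i]) : a != -1 \/ a + a != -1.
  have [->|] := eqVneq a (-1); last by left.
  by right; rewrite -opprD eqr_opp.
move=> [bA|bA].
  have [[z <-]|nu] := pselect (exists z, A z = u); last first.
    by left; left; exact: bounded_below_perturb_out.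
  have [fz|fz] := two (f z); [left|right]; left.
    exact: bounded_below_perturb_in.
  by rewrite -appD; apply: bounded_below_perturb_in => //; rewrite appD.
have [[z [Az fz]]|nz] := pselect (exists z, A z = 0 /\ f z != 0).
  left; right; apply: (@bounded_onto_perturb_ker _ _ _ _ _ _ ((f z)^-1 *: z)) => //.
    by rewrite appZ Az scaler0.
  by rewrite dualZ; exact: mulVf.
have [|h hA] := bounded_onto_factor bA (f := f).
  move=> z Az; apply/eqP; apply: contrapT => fz; apply: nz; exists z.
  by split=> //; exact/negP.
have [hu|hu] := two (h u); [left|right]; right.
  exact: bounded_onto_perturb_dual hA hu bA.
by apply: bounded_onto_perturb_dual hA _ bA; rewrite appD.
Qed.

Lemma rank_le1P X (T : 'B(X)) :
  rank_le1 T <-> forall A, semi_invertible A ->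
    semi_invertible (A + T) \/ semi_invertible (A + T + T).
Proof.
split=> [rT A|sT]; first exact: rank_le1_semi.
apply: contrapT => /rank_ge2[x1 [x2 [f1 [f2 [f11 f12 f21 f22]]]]].
have [A [A' [AA' nA nA2]]] := two_defects f11 f12 f21 f22.
have [] // := sT A; left; exact: inverses_bounded_below AA'.1.
Qed.

End RankOneCharacterization.

(** * Lines of rank one operators *)

Section RankOneLines.
Local Open Scope complex_scope.
Context {R : realType} {V : normedModType R[i]}.
Hypothesis dimV : forall x : V, exists y, forall c : R[i], y <> c *: x.
Implicit Types (T S : 'B(V)) (x y : V) (f g : dual V).

Definition ranged x T := exists f, T = rank1 x f.
Definition kerneled f T := exists x, T = rank1 x f.

Lemma dual_dim_ge2 f : exists g, forall c : R[i], g <> c *: f.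
Proof.
have [->|f0] := eqVneq f 0.
  have [x xP] := dimV 0.
  have [g gx] := separating_functional (nonproportional_neq0 xP).
  have [_ /eqP gn0] := functional_eq1_neq0 gx.
  by exists g => c gc; apply: gn0; rewrite gc scaler0.
have [x fx] := functional_neq0 f0; have [y yP] := dimV x.
have [|g gz] := @separating_functional _ _ (y - (f y : R[i]) *: x).
  by apply/eqP => /eqP; rewrite subr_eq0 => /eqP; exact: yP.
exists g => c gc; move/eqP: gz.
rewrite gc bopZE appB dualZ fx mulr1 subrr scaler0 eq_sym; apply/negP.
exact: oner_neq0.
Qed.

Lemma rank1_eql x x' f f' : f != 0 -> rank1 x f = rank1 x' f' ->
  exists c : R[i], x = c *: x'.
Proof.
move=> /functional_neq0[z fz] e; exists (f' z).
by have := congr1 (fun T : 'B(V) => T z) e; rewrite !rank1E fz scale1r.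
Qed.

Lemma rank1_eqr x x' f f' : x != 0 -> rank1 x f = rank1 x' f' ->
  exists c : R[i], f = c *: f'.
Proof.
move=> /separating_functional[h hx] e; exists (h x'); apply: bop_ext => z.
have := congr1 (fun T : 'B(V) => h (T z)) e.
by rewrite !rank1E !dualZ hx mulr1 bopZE => ->; rewrite mulrC.
Qed.

(** If neither pair were dependent, evaluating at a vector killed by f but not
by f' would make u a multiple of x', and then evaluating where f is 1 would
make x a multiple of x'. *)
Lemma rank_le1_sum x x' f f' : x != 0 -> f != 0 ->
  rank_le1 (rank1 x f + rank1 x' f') ->
  (exists c : R[i], x' = c *: x) \/ (exists c : R[i], f' = c *: f).
Proof.
move=> x0 f0 [u [g ug]]; have [//|nx'] := pselect (exists c : R[i], x' = c *: x).
  by left.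
right; apply: contrapT => nf'.
have [w fw] := functional_neq0 f0.
have [z [fz f'z]] : exists z, f z = 0 /\ f' z != 0.
  apply: contrapT => nz; apply: nf'; exists (f' w); apply: bop_ext => z.
  have fz0 : f (z - (f z : R[i]) *: w) = 0 by rewrite appB dualZ fw mulr1 subrr.
  have : f' (z - (f z : R[i]) *: w) = 0.
    apply/eqP; apply: contrapT => h; apply: nz.
    by eexists; split; [exact: fz0|exact/negP].
  by rewrite appB dualZ bopZE => /eqP; rewrite subr_eq0 => /eqP ->; exact: mulrC.
have x'u : x' = (((f' z : R[i])^-1 * (g z : R[i])) : R[i]) *: u.
  have := congr1 (fun T : 'B(V) => T z) ug.
  rewrite bopDE !rank1E fz scale0r add0r -scalerA => <-.
  by rewrite scalerA mulVf// scale1r.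
have xu : x = (g w : R[i]) *: u - (f' w : R[i]) *: x'.
  have := congr1 (fun T : 'B(V) => T w) ug.
  by rewrite bopDE !rank1E fw scale1r => <-; rewrite addrK.
set a : R[i] := _ * _ in x'u.
have a0 : a != 0.
  by apply/eqP => a0; apply: nx'; exists 0; rewrite scale0r x'u a0 scale0r.
have u' : u = a^-1 *: x' by rewrite x'u scalerA mulVf// scale1r.
have {}xu : x = ((g w : R[i]) * a^-1 - (f' w : R[i])) *: x'.
  by rewrite scalerBl -scalerA -u'.
set b : R[i] := _ - _ in xu.
have b0 : b != 0 by apply: contra x0 => /eqP b0; rewrite xu b0 scale0r.
by apply: nx'; exists b^-1; rewrite xu scalerA mulVf// scale1r.
Qed.

Lemma ranged_scale x x' (c : R[i]) T : x' != 0 -> x' = c *: x ->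
  ranged x' T <-> ranged x T.
Proof.
move=> x'0 x'E; have c0 : c != 0.
  by apply: contra x'0 => /eqP c0; rewrite x'E c0 scale0r.
split=> -[f ->].
  by exists (c *: f); rewrite x'E rank1Zl rank1Zr.
by exists (c^-1 *: f); rewrite x'E rank1Zl rank1Zr scalerA divff// scale1r.
Qed.

Lemma kerneled_scale f f' (c : R[i]) T : f' != 0 -> f' = c *: f ->
  kerneled f' T <-> kerneled f T.
Proof.
move=> f'0 f'E; have c0 : c != 0.
  by apply: contra f'0 => /eqP c0; rewrite f'E c0 scale0r.
split=> -[x ->].
  by exists (c *: x); rewrite f'E rank1Zl rank1Zr.
by exists (c^-1 *: x); rewrite f'E rank1Zl rank1Zr scalerA mulVf// scale1r.
Qed.

Lemma ranged_meet x x' T S : T != 0 -> ranged x T -> ranged x' T ->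
  ranged x S <-> ranged x' S.
Proof.
move=> T0 [f Tf] [f' Tf'].
have : rank1 x f != 0 by rewrite -Tf.
rewrite rank1_eq0 negb_or => /andP[x0 f0].
have [|c xc] := @rank1_eql x x' f f' f0; first by rewrite -Tf.
exact: ranged_scale x0 xc.
Qed.

Lemma kerneled_meet f f' T S : T != 0 -> kerneled f T -> kerneled f' T ->
  kerneled f S <-> kerneled f' S.
Proof.
move=> T0 [x Tx] [x' Tx'].
have : rank1 x f != 0 by rewrite -Tx.
rewrite rank1_eq0 negb_or => /andP[x0 f0].
have [|c fc] := @rank1_eqr x x' f f' x0; first by rewrite -Tx.
exact: kerneled_scale f0 fc.
Qed.

Lemma ranged_not_kerneled x f : x != 0 ->
  ~ (forall T, ranged x T -> kerneled f T).
Proof.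
move=> x0 h; have [g gP] := dual_dim_ge2 f.
have [|y /(rank1_eqr x0)[c]] := h (rank1 x g); first by exists g.
exact: gP.
Qed.

Lemma kerneled_not_ranged x f : f != 0 ->
  ~ (forall T, kerneled f T -> ranged x T).
Proof.
move=> f0 h; have [y yP] := dimV x.
have [|g /(rank1_eql f0)[c]] := h (rank1 y f); first by exists y.
exact: yP.
Qed.

(** The maximal additive groups of operators of rank at most one, given up to
equivalence of predicates. *)
Variant line (L : 'B(V) -> Prop) : Prop :=
| RangeLine x of x != 0 & (forall T, L T <-> ranged x T)
| KernelLine f of f != 0 & (forall T, L T <-> kerneled f T).

Lemma line_maximal L L' : line L -> line L' -> (forall T, L T -> L' T) ->
  forall T, L' T -> L T.
Proof.
have [f nf] := dual_dim_ge2 0; have [y ny] := dimV 0.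
have [f0 y0] := (nonproportional_neq0 nf, nonproportional_neq0 ny).
move=> [x x0 Lx|g g0 Lg] [x' x'0 L'x|g' g'0 L'g] LL' T.
- move=> /L'x h; apply/Lx.
  apply/(@ranged_meet x x' (rank1 x f)) => //.
  + by rewrite rank1_eq0 negb_or x0.
  + by exists f.
  + by apply/L'x/LL'/Lx; exists f.
- by case: (@ranged_not_kerneled x g' x0) => S /Lx/LL'/L'g.
- by case: (@kerneled_not_ranged x' g g0) => S /Lg/LL'/L'x.
- move=> /L'g h; apply/Lg.
  apply/(@kerneled_meet g g' (rank1 y g)) => //.
  + by rewrite rank1_eq0 negb_or y0.
  + by exists y.
  + by apply/L'g/LL'/Lg; exists y.
Qed.

(** If two members S1 and S2 have different ranges, they share their kernel; a
third member with another kernel would have to share its range with both. *)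
Lemma rank_le1_group (G : 'B(V) -> Prop) :
  (forall S T, G S -> G T -> G (S + T)) -> (forall T, G T -> rank_le1 T) ->
  exists2 L, line L & forall T, G T -> L T.
Proof.
move=> GD G1.
have [y ny] := dimV 0.
have y0 := nonproportional_neq0 ny.
have [[S1 [GS1 S10]]|Gz] := pselect (exists S, G S /\ S != 0); last first.
  exists (ranged y); first exact: RangeLine y0 _.
  move=> T GT; exists 0; rewrite rank10r; apply/eqP; apply: contrapT => T0.
  by apply: Gz; exists T; split=> //; exact/negP.
have [x1 [f1 S1E]] := G1 _ GS1.
move: S10; rewrite S1E rank1_eq0 negb_or => /andP[x10 f10].
have [in1|] := pselect (forall T, G T -> ranged x1 T).
  by exists (ranged x1) => //; exact: RangeLine x10 _.
move=> /existsNP[S2 /not_implyP[GS2 nS2]].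
have [x2 [f2 S2E]] := G1 _ GS2.
have x2n : ~ exists c : R[i], x2 = c *: x1.
  move=> [c x2c]; apply: nS2; exists (c *: f2).
  by rewrite S2E x2c rank1Zl rank1Zr.
have f20 : f2 != 0.
  by apply/eqP => f20; apply: nS2; exists 0; rewrite S2E f20 !rank10r.
have [|//|[c f2c]] := @rank_le1_sum x1 x2 f1 f2 x10 f10.
  by rewrite -S1E -S2E; exact/G1/GD.
have x20 : x2 != 0.
  by apply/eqP => x20; apply: x2n; exists 0; rewrite scale0r.
exists (kerneled f1); first exact: KernelLine f10 _.
move=> T GT; have [x3 [f3 TE]] := G1 _ GT.
have [[d f3d]|f3n] := pselect (exists d : R[i], f3 = d *: f1).
  by exists (d *: x3); rewrite TE f3d rank1Zl rank1Zr.
have [|[d x3d]|//] := @rank_le1_sum x1 x3 f1 f3 x10 f10.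
  by rewrite -S1E -TE; exact/G1/GD.
have [|[d' x3d']|[d' f3d']] := @rank_le1_sum x2 x3 f2 f3 x20 f20.
- by rewrite -S2E -TE; exact/G1/GD.
- have [x30|x30] := eqVneq x3 0.
    by exists 0; rewrite TE x30 !rank10l.
  case: x2n; exists (d'^-1 * d); rewrite -scalerA -x3d x3d' scalerA mulVf ?scale1r//.
  by apply: contra x30 => /eqP d'0; rewrite x3d' d'0 scale0r.
- by case: f3n; exists (d' * c); rewrite f3d' f2c scalerA.
Qed.

End RankOneLines.

Section LinePreservers.
Local Open Scope complex_scope.
Context {R : realType} {V W : normedModType R[i]}.
Hypothesis dimV : forall x : V, exists y, forall c : R[i], y <> c *: x.
Hypothesis dimW : forall x : W, exists y, forall c : R[i], y <> c *: x.
Variable phi : 'B(V) -> 'B(W).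
Hypothesis phiD : {morph phi : S T / S + T}.
Hypothesis phi_inj : injective phi.
Hypothesis phi_surj : forall S, exists T, phi T = S.
Hypothesis phi_rank : forall T, rank_le1 (phi T) <-> rank_le1 T.

Lemma line_rank_le1 (U : normedModType R[i]) (L : 'B(U) -> Prop) T :
  line L -> L T -> rank_le1 T.
Proof.
by case=> [x _ Lx /Lx[f]|f _ Lf /Lf[x]] ->; [exists x, f|exists x, f].
Qed.

Lemma line_add (U : normedModType R[i]) (L : 'B(U) -> Prop) S T :
  line L -> L S -> L T -> L (S + T).
Proof.
case=> [x _ Lx /Lx[f ->] /Lx[g ->]|f _ Lf /Lf[x ->] /Lf[y ->]].
  by apply/Lx; exists (f + g); rewrite rank1Dr.
by apply/Lf; exists (x + y); rewrite rank1Dl.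
Qed.

(** The image of L is an additive group of operators of rank at most one, so it
lies in a line L'; pulling L' back gives a group inside a line that contains
L, and maximality turns both inclusions into equalities. *)
Lemma line_image L : line L ->
  exists2 L', line L' & forall T, L' (phi T) <-> L T.
Proof.
move=> lL.
have [||L' lL' LL'] := rank_le1_group dimW (G := fun S => exists2 T, L T & S = phi T).
- move=> _ _ [S LS ->] [T LT ->]; exists (S + T) => //.
  exact: line_add lL LS LT.
- by move=> _ [T LT ->]; apply/phi_rank; exact: line_rank_le1 lL LT.
exists L' => // T; split=> [L'T|LT]; last by apply: LL'; exists T.
have [||L'' lL'' L'L''] := rank_le1_group dimV (G := fun T => L' (phi T)).
- by move=> S S' L'S L'S'; rewrite phiD; exact: line_add lL' L'S L'S'.
- by move=> S L'S; apply/phi_rank; exact: line_rank_le1 lL' L'S.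
apply: (line_maximal dimV lL lL'') (L'L'' _ L'T) => S LS.
by apply: L'L''; apply: LL'; exists S.
Qed.

(** Lines of different types always share a nonzero operator, and lines of the
same type with a common nonzero operator are equal. So the type of the image
of one range line decides the types of all images. *)
Lemma line_types :
  ((forall x, x != 0 -> exists2 y, y != 0 &
      forall T, ranged y (phi T) <-> ranged x T) /\
   (forall f, f != 0 -> exists2 g, g != 0 &
      forall T, kerneled g (phi T) <-> kerneled f T)) \/
  ((forall x, x != 0 -> exists2 g, g != 0 &
      forall T, kerneled g (phi T) <-> ranged x T) /\
   (forall f, f != 0 -> exists2 y, y != 0 &
      forall T, ranged y (phi T) <-> kerneled f T)).
Proof.
have [x0 nx0] := dimV 0.
have x00 := nonproportional_neq0 nx0; have phi0 := additive0 phiD.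
have phi_neq0 T : T != 0 -> phi T != 0.
  by apply: contra => /eqP h; apply/eqP/phi_inj; rewrite phi0.
have rline (x : V) : x != 0 -> line (ranged x) by move=> h; exact: RangeLine h _.
have kline (f : dual V) : f != 0 -> line (kerneled f) by move=> h; exact: KernelLine h _.
(* If range lines had images of both types, these images would meet in
   rank1 y g, so the range lines would be equal, and so would their images. *)
have cross x x' y g : y != 0 -> g != 0 ->
    (forall T, ranged y (phi T) <-> ranged x T) ->
    (forall T, kerneled g (phi T) <-> ranged x' T) -> False.
  move=> yn0 gn0 Hy Hg; have [T TE] := phi_surj (rank1 y g).
  have T0 : T != 0.
    apply/eqP => T0; move: (rank1_eq0 y g).
    by rewrite -TE T0 phi0 eqxx (negPf yn0) (negPf gn0).
  have xT : ranged x T by apply/Hy; exists g.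
  have x'T : ranged x' T by apply/Hg; exists y.
  apply: (@ranged_not_kerneled _ _ dimW y g yn0) => S.
  have [S' <-] := phi_surj S => /Hy h; apply/Hg.
  exact/(ranged_meet _ T0 xT x'T).
have [L' [y0 y00 L'y|g0 g00 L'g] L'P] := line_image (rline x0 x00).
  have Hx0 T : ranged y0 (phi T) <-> ranged x0 T.
    by rewrite -L'P; split=> /L'y.
  left; split=> [x xn0|f f0].
    have [L1 [y yn0 L1y|g gn0 L1g] L1P] := line_image (rline x xn0).
      by exists y => // T; rewrite -L1P; split=> /L1y.
    by case: (@cross x0 x y0 g) => // T; rewrite -L1P; split=> /L1g.
  have [L1 [y yn0 L1y|g gn0 L1g] L1P] := line_image (kline f f0); last first.
    by exists g => // T; rewrite -L1P; split=> /L1g.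
  have T0 : phi (rank1 x0 f) != 0.
    by apply: phi_neq0; rewrite rank1_eq0 negb_or x00.
  have y0T : ranged y0 (phi (rank1 x0 f)) by apply/Hx0; exists f.
  have yT : ranged y (phi (rank1 x0 f)) by apply/L1y/L1P; exists x0.
  case: (@ranged_not_kerneled _ _ dimV x0 f x00) => T /Hx0 h.
  exact/L1P/L1y/(ranged_meet _ T0 y0T yT).
have Hx0 T : kerneled g0 (phi T) <-> ranged x0 T.
  by rewrite -L'P; split=> /L'g.
right; split=> [x xn0|f f0].
  have [L1 [y yn0 L1y|g gn0 L1g] L1P] := line_image (rline x xn0).
    by case: (@cross x x0 y g0) => // T; rewrite -L1P; split=> /L1y.
  by exists g => // T; rewrite -L1P; split=> /L1g.
have [L1 [y yn0 L1y|g gn0 L1g] L1P] := line_image (kline f f0).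
  by exists y => // T; rewrite -L1P; split=> /L1y.
have T0 : phi (rank1 x0 f) != 0.
  by apply: phi_neq0; rewrite rank1_eq0 negb_or x00.
have g0T : kerneled g0 (phi (rank1 x0 f)) by apply/Hx0; exists f.
have gT : kerneled g (phi (rank1 x0 f)) by apply/L1g/L1P; exists x0.
case: (@ranged_not_kerneled _ _ dimV x0 f x00) => T /Hx0 h.
exact/L1P/L1g/(kerneled_meet _ T0 g0T gT).
Qed.

End LinePreservers.

(** * Two actions of the operators on X *)

Section OperatorPairing.
Local Open Scope complex_scope.
Context {R : realType} {X : completeNormedModType R[i]}.
Context {E F : normedModType R[i]}.

(** The common features of X paired with its dual and of the dual paired with X,
which let one argument serve both cases of the theorem. Here b is the
pairing, OP e f the rank one operator on X given by e and f, and rho T the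
action of T on E. In the second case rho reverses products, so only its
compatibility with inverses is recorded. *)
Record operator_pairing (b : E -> F -> R[i]) (OP : E -> F -> 'B(X))
    (rho : 'B(X) -> E -> E) : Prop := OperatorPairing {
  pairing_linl : forall a e e' f, b (a *: e + e') f = a * b e f + b e' f;
  pairing_linr : forall a e f f', b e (a *: f + f') = a * b e f + b e f';
  pairing_sepl : forall e, e != 0 -> exists f, b e f = 1;
  pairing_sepr : forall f, f != 0 -> exists e, b e f = 1;
  pairing_bound : forall e f,
    rnorm (b e f : R[i]^o) <= rnorm e * rnorm f;
  pairing_norming : forall e K, 0 <= K ->
    (forall f, rnorm (b e f : R[i]^o) <= K * rnorm f) -> rnorm e <= K;
  rank_oneDl : forall e e' f, OP (e + e') f = OP e f + OP e' f;
  rank_oneDr : forall e f f', OP e (f + f') = OP e f + OP e f';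
  rank_oneZ : forall a e f, OP (a *: e) f = OP e (a *: f);
  rank_one_norm : forall e f, opnorm (OP e f) = rnorm e * rnorm f;
  rank_one_semi : forall T T' e f, inverses T T' ->
    (semi_invertible (T + OP e f) <-> b (rho T' e) f != -1);
  rank_one_shift : forall a e f, a != 0 -> b e f != - a ->
    exists S, inverses (a *: idop X + OP e f) S;
  rep_lin : forall T a e e', rho T (a *: e + e') = a *: rho T e + rho T e';
  rep_add : forall S T e, rho (S + T) e = rho S e + rho T e;
  rep_scalar : forall a e, rho (a *: idop X) e = a *: e;
  rep_inverses : forall T T', inverses T T' -> cancel (rho T) (rho T');
  rep_rank_one : forall e f e', rho (OP e f) e' = b e' f *: e
}.

End OperatorPairing.

Section DualNorm.
Context {R : realType} {V : normedModType R[i]}.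

Lemma norming_dual (x : V) (K : R) : 0 <= K ->
  (forall f : dual V, rnorm (f x) <= K * rnorm f) -> rnorm x <= K.
Proof.
move=> K0 fK; have [->|x0] := eqVneq x 0; first by rewrite rnorm0.
have [f [fx f1]] := norming_functional x0.
have -> : rnorm x = rnorm (f x) by rewrite fx rnormC ger0_norm// rnorm_ge0.
rewrite (le_trans (fK f))// ler_piMr// bop_rnormE; apply: opnorm_le => y y1.
exact: le_trans (f1 y) y1.
Qed.

Lemma adjointE (T : 'B(V)) (f : dual V) (x : V) : adjoint T f x = f (T x).
Proof. by []. Qed.

End DualNorm.

Section PairingInstances.
Local Open Scope complex_scope.
Context {R : realType} {X : completeNormedModType R[i]}.

Lemma rank1_shift (a : R[i]) (x : X) (f : dual X) : a != 0 ->
  (f x : R[i]) != - a -> exists S, inverses (a *: idop X + rank1 x f) S.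
Proof.
move=> a0 fx; apply: (inverses_perturb (inverses_scale X a0)).
rewrite bopZE idopE dualZ; apply: contra fx => /eqP e1; apply/eqP.
by rewrite -[LHS](mulVKf a0) e1 mulrN1.
Qed.

Lemma direct_pairing : operator_pairing (fun x (f : dual X) => f x)
  (fun x f => rank1 x f) (fun (T : 'B(X)) x => T x).
Proof.
split.
- by move=> a e e' f; rewrite appD dualZ.
- by [].
- by move=> e; exact: separating_functional.
- by move=> f; exact: functional_neq0.
- by move=> e f; rewrite mulrC; exact: opnormP.
- exact: norming_dual.
- by move=> e e' f; rewrite rank1Dl.
- by move=> e f f'; rewrite rank1Dr.
- by move=> a e f; rewrite rank1Zl rank1Zr.
- by move=> e f; rewrite opnorm_rank1.
- by move=> T T' e f; exact: semi_invertible_perturb.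
- by move=> a e f; exact: rank1_shift.
- by move=> T a e e'; rewrite appD appZ.
- by [].
- by [].
- by move=> T T' [].
- by [].
Qed.

Lemma adjoint_pairing : operator_pairing (fun (f : dual X) x => f x)
  (fun f x => rank1 x f) (fun (T : 'B(X)) f => adjoint T f).
Proof.
split.
- by [].
- by move=> a f x x'; rewrite appD dualZ.
- by move=> f; exact: functional_neq0.
- by move=> e; exact: separating_functional.
- by move=> f x; exact: opnormP.
- move=> f K K0 fK; rewrite bop_rnormE; apply: opnorm_le => x x1.
  by rewrite (le_trans (fK x))// ler_piMr.
- by move=> f f' x; rewrite rank1Dr.
- by move=> f x x'; rewrite rank1Dl.
- by move=> a f x; rewrite rank1Zl rank1Zr.
- by move=> f x; rewrite opnorm_rank1 mulrC.
- by move=> T T' f x; exact: semi_invertible_perturb.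
- by move=> a f x; exact: rank1_shift.
- by move=> T a f f'; rewrite appD appZ.
- by move=> S T f; apply: bop_ext => x; rewrite bopDE !adjointE bopDE appD.
- by move=> a f; apply: bop_ext => x; rewrite adjointE !bopZE idopE dualZ.
- by move=> T T' [_ TK] f; apply: bop_ext => x; rewrite !adjointE TK.
- by move=> f x f'; apply: bop_ext => y; rewrite adjointE rank1E dualZ bopZE mulrC.
Qed.

End PairingInstances.

(** * Field endomorphisms preserving the modulus *)

Section NormPreservingEndomorphism.
Local Open Scope complex_scope.
Context {R : realType}.

(** A complex number z with |z| = |r| and |z - 1| = |r - 1| for a real r is r
itself, so t fixes the reals; and t i is a square root of -1. *)
Lemma norm_preserving_rmorph (t : R[i] -> R[i]) :
  {morph t : a b / a + b} -> {morph t : a b / a * b} -> t 1 = 1 ->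
  (forall a, `|t a| = `|a|) -> t =1 id \/ t =1 conjc.
Proof.
move=> tD tM t1 tn.
have sq (z : R[i]) : complex.Re z ^+ 2 + complex.Im z ^+ 2 = complex.Re (`|z| ^+ 2).
  by rewrite -add_Re2_Im2.
have tN := additiveN tD.
have tR (r : R) : t r%:C = r%:C.
  have n0 : `|t r%:C| = `|r%:C| by exact: tn.
  have n1 : `|t r%:C - 1| = `|r%:C - 1| by rewrite -{1}t1 -tN -tD tn.
  have := sq (t r%:C - 1); rewrite n1 -sq; have := sq (t r%:C); rewrite n0 -sq.
  case: (t r%:C) => u v /=; rewrite expr0n /= !subr0 expr0n /= !addr0 => h1 h2.
  have e1 : u = r by nra.
  have v2 : v ^+ 2 = 0 by rewrite e1 in h1; nra.
  by move/eqP: v2; rewrite sqrf_eq0 e1 => /eqP ->.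
have ti : t 'i = 'i \/ t 'i = - 'i.
  have : t 'i ^+ 2 = 'i ^+ 2 by rewrite expr2 -tM -expr2 sqr_i tN t1.
  by move/eqP; rewrite eqf_sqr => /orP[]/eqP; [left|right].
case: ti => ti; [left|right] => a; rewrite [a]complexE tD tM !tR ti //.
by simpc.
Qed.
End NormPreservingEndomorphism.

(** * Additive maps preserving rank one *)

Section LocallyDependent.
Local Open Scope complex_scope.
Context {R : realType} {E : zmodType} {Y : normedModType R[i]}.
Hypothesis dimY : forall y : Y, exists z, forall c : R[i], z <> c *: y.
Variables A A' : E -> Y.
Hypothesis AD : {morph A : x y / x + y}.
Hypothesis A'D : {morph A' : x y / x + y}.
Hypothesis A_surj : forall y, exists e, A e = y.
Hypothesis A_dep : forall e, exists c : R[i], A' e = c *: A e.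

(** At two vectors with independent values of A, additivity forces the two
factors to agree; any two nonzero values are compared through a third one
independent of both. *)
Lemma locally_dependent_add : exists c : R[i], forall e, A' e = c *: A e.
Proof.
have indep (e1 e2 : E) (c1 c2 : R[i]) : A e1 != 0 ->
    (forall c : R[i], A e2 <> c *: A e1) ->
    A' e1 = c1 *: A e1 -> A' e2 = c2 *: A e2 -> c1 = c2.
  move=> n1 n2 h1 h2; have [c] := A_dep (e1 + e2).
  rewrite A'D AD h1 h2 scalerDr => h.
  have {}h : (c2 - c) *: A e2 = (c - c1) *: A e1.
    rewrite !scalerBl; apply/eqP; rewrite subr_eq addrAC eq_sym subr_eq.
    by rewrite -h addrC.
  have [c2c|c2c] := eqVneq (c2 - c) 0.
    move: h; rewrite c2c scale0r => /esym/eqP; rewrite scaler_eq0 (negPf n1) orbF.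
    by rewrite subr_eq0 => /eqP <-; apply/eqP; rewrite -subr_eq0 -opprB c2c oppr0.
  case: (n2 ((c2 - c)^-1 * (c - c1))).
  by rewrite -scalerA -h scalerA mulVf// scale1r.
have [z0 nz0] := dimY 0; have [e1 Ae1] := A_surj z0.
have n1 : A e1 != 0 by rewrite Ae1; exact: nonproportional_neq0 nz0.
have [z2 nz2] := dimY z0; have [e2 Ae2] := A_surj z2.
have n21 : forall c : R[i], A e2 <> c *: A e1 by move=> c; rewrite Ae1 Ae2.
have n2 := nonproportional_neq0 n21.
have [[c1 h1] [c2 h2]] := (A_dep e1, A_dep e2).
exists c1 => e; have [c h] := A_dep e; rewrite h.
have [->|Ae0] := eqVneq (A e) 0; first by rewrite !scaler0.
congr (_ *: _).
have [[k Aek]|ne] := pselect (exists k : R[i], A e = k *: A e1); last first.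
  by apply/esym/(indep e1 e) => // k Aek; apply: ne; exists k.
rewrite (indep e1 e2 c1 c2) //; apply/esym/(indep e2 e) => // m Aem.
have m0 : m != 0 by apply: contra Ae0 => /eqP m0; rewrite Aem m0 scale0r.
apply: (n21 (m^-1 * k)).
by rewrite -scalerA -Aek Aem scalerA mulVf// scale1r.
Qed.
End LocallyDependent.

Section Factorization.
Local Open Scope complex_scope.
Context {R : realType} {X Y : completeNormedModType R[i]}.
Context {E F : normedModType R[i]}.
Hypothesis dimY : forall y : Y, exists z, forall c : R[i], z <> c *: y.
Variables (b : E -> F -> R[i]) (OP : E -> F -> 'B(X)) (rho : 'B(X) -> E -> E).
Hypothesis pair : operator_pairing b OP rho.
Variables (e0 : E) (f0 : F).
Hypotheses (e0_neq0 : e0 != 0) (f0_neq0 : f0 != 0).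
Variable phi : 'B(X) -> 'B(Y).
Hypothesis phiD : {morph phi : S T / S + T}.
Hypothesis phi_inj : injective phi.
Hypothesis phi_surj : forall S, exists T, phi T = S.
Hypothesis phi_range : forall e, e != 0 -> exists2 u, u != 0 &
  forall T, ranged u (phi T) <-> exists f, T = OP e f.
Hypothesis phi_kernel : forall f, f != 0 -> exists2 g, g != 0 &
  forall T, kerneled g (phi T) <-> exists e, T = OP e f.

Lemma rank_one_neq0 e f : e != 0 -> f != 0 -> OP e f != 0.
Proof.
move=> en0 fn0; rewrite -rnorm_gt0 bop_rnormE (rank_one_norm pair).
by rewrite mulr_gt0// rnorm_gt0.
Qed.

Lemma rank_one0l f : OP 0 f = 0.
Proof. by apply: (additive0 (h := OP^~ f)) => e e'; exact: (rank_oneDl pair). Qed.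

Lemma rank_one0r e : OP e 0 = 0.
Proof. by apply: additive0 => f f'; exact: (rank_oneDr pair). Qed.

(** For fixed f the operators OP e f have images with a common kernel, which
gives an additive map from E to Y; since for fixed e the images have a common
range, the maps obtained for two values of f are locally dependent, hence
proportional, and the factor is absorbed in C f. *)
Lemma factorization : exists (A : E -> Y) (C : F -> dual Y) (t : R[i] -> R[i]),
  [/\ {morph A : x y / x + y}, bijective A, {morph C : x y / x + y} &
     forall g, exists f, C f = g] /\
  [/\ forall e f, phi (OP e f) = rank1 (A e) (C f),
      forall a e, A (a *: e) = t a *: A e &
      forall a f, C (a *: f) = t a *: C f].
Proof.
have phi0 := additive0 phiD; have [g0 g00 Hg0] := phi_kernel f0_neq0.
have /choice[A AP] : forall e, exists y, phi (OP e f0) = rank1 y g0.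
  by move=> e; apply/(Hg0 (OP e f0)); exists e.
have AD : {morph A : x y / x + y}.
  move=> x y; apply: (rank1_injl g00).
  by rewrite -AP (rank_oneDl pair) phiD !AP rank1Dl.
have A_surj y : exists e, A e = y.
  have [T TE] := phi_surj (rank1 y g0).
  have [|e Te] := (Hg0 T).1; first by exists y.
  by exists e; apply: (rank1_injl g00); rewrite -AP -Te TE.
have A_neq0 e : e != 0 -> A e != 0.
  move=> en0; have := rank_one_neq0 en0 f0_neq0; apply: contra => /eqP Ae0.
  by apply/eqP/phi_inj; rewrite AP Ae0 rank10l phi0.
have A_inj : injective A.
  move=> x y Axy; apply/eqP; rewrite -subr_eq0; apply: contrapT => /negP.
  by move=> /A_neq0; rewrite AD (additiveN AD) Axy subrr eqxx.
have A_bij : bijective A.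
  have [B BK] := choice A_surj; exists B => // x; exact: A_inj.
have /choice[C CP] : forall f, exists h, forall e, phi (OP e f) = rank1 (A e) h.
  move=> f; have [->|fn0] := eqVneq f 0.
    by exists 0 => e; rewrite rank_one0r phi0 rank10r.
  have [g gn0 Hg] := phi_kernel fn0.
  have /choice[A' A'P] : forall e, exists y, phi (OP e f) = rank1 y g.
    by move=> e; apply/(Hg (OP e f)); exists e.
  have A'D : {morph A' : x y / x + y}.
    move=> x y; apply: (rank1_injl gn0).
    by rewrite -A'P (rank_oneDl pair) phiD !A'P rank1Dl.
  have dep e : exists c : R[i], A' e = c *: A e.
    have [->|en0] := eqVneq e 0.
      exists 0; rewrite scale0r; apply: (rank1_injl gn0).
      by rewrite -A'P rank_one0l phi0 rank10l.
    have [u un0 Hu] := phi_range en0.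
    have [h Ah] : ranged u (rank1 (A e) g0) by rewrite -AP; apply/Hu; exists f0.
    have [h' A'h] : ranged u (rank1 (A' e) g) by rewrite -A'P; apply/Hu; exists f.
    have [c Ac] := rank1_eql g00 Ah; have [c' A'c] := rank1_eql gn0 A'h.
    have c0 : c != 0.
      by apply: contra (A_neq0 _ en0) => /eqP c0; rewrite Ac c0 scale0r.
    by exists (c' * c^-1); rewrite A'c -scalerA Ac [c^-1 *: _]scalerA mulVf// scale1r.
  have [c cP] := locally_dependent_add dimY AD A'D A_surj dep.
  by exists (c *: g) => e; rewrite A'P cP rank1Zl rank1Zr.
have C_surj g : exists f, C f = g.
  have [u un0 Hu] := phi_range e0_neq0.
  have [h Ah] : ranged u (rank1 (A e0) g0) by rewrite -AP; apply/Hu; exists f0.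
  have [c Ac] := rank1_eql g00 Ah.
  have [T TE] := phi_surj (rank1 (A e0) g).
  have [|f Tf] := (Hu T).1.
    by exists (c *: g); rewrite TE Ac rank1Zl rank1Zr.
  by exists f; apply: (rank1_injr (A_neq0 _ e0_neq0)); rewrite -CP -Tf TE.
have [z gz] := functional_neq0 g00.
pose t (a : R[i]) : R[i] := C (a *: f0) z.
have tA a e : A (a *: e) = t a *: A e.
  have := AP (a *: e); rewrite (rank_oneZ pair) CP.
  move=> /(congr1 (fun T : 'B(Y) => T z)).
  by rewrite !rank1E gz scale1r.
have CD : {morph C : x y / x + y}.
  move=> f f'; apply: (rank1_injr (A_neq0 _ e0_neq0)).
  by rewrite -CP (rank_oneDr pair) phiD !CP rank1Dr.
exists A, C, t; split=> //; split=> // a f.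
apply: (rank1_injr (A_neq0 _ e0_neq0)).
by rewrite -CP -(rank_oneZ pair) CP tA rank1Zl rank1Zr.
Qed.

End Factorization.

(** * The formula for phi, and its isometric factors *)

Section IsometricForm.
Local Open Scope complex_scope.
Context {R : realType} {X Y : completeNormedModType R[i]}.
Context {E F : normedModType R[i]}.
Variables (b : E -> F -> R[i]) (OP : E -> F -> 'B(X)) (rho : 'B(X) -> E -> E).
Hypothesis pair : operator_pairing b OP rho.
Variables (x0 : X) (e0 : E) (f0 : F).
Hypotheses (x0_neq0 : x0 != 0) (e0_neq0 : e0 != 0) (f0_neq0 : f0 != 0).
Variable phi : 'B(X) -> 'B(Y).
Hypothesis phiD : {morph phi : S T / S + T}.
Hypothesis phi_semi : forall T, semi_invertible (phi T) <-> semi_invertible T.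
Hypothesis phi_max : forall T, max_modulus (phi T) = max_modulus T.
Variables (A : E -> Y) (C : F -> dual Y) (t : R[i] -> R[i]) (Ai : Y -> E).
Hypothesis AD : {morph A : x y / x + y}.
Hypotheses (AK : cancel A Ai) (AiK : cancel Ai A).
Hypothesis CD : {morph C : x y / x + y}.
Hypothesis C_surj : forall g, exists f, C f = g.
Hypothesis phi_OP : forall e f, phi (OP e f) = rank1 (A e) (C f).
Hypothesis AZ : forall a e, A (a *: e) = t a *: A e.
Hypothesis CZ : forall a f, C (a *: f) = t a *: C f.

Let A0 : A 0 = 0 := additive0 AD.
Let C0 : C 0 = 0 := additive0 CD.

Let A_neq0 e : e != 0 -> A e != 0.
Proof. by apply: contra => /eqP Ae; rewrite -[e]AK Ae -A0 AK. Qed.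

Let scal_inj (y : Y) : y != 0 -> injective (fun a : R[i] => a *: y).
Proof.
move=> y0 a a' /eqP; rewrite -subr_eq0 -scalerBl scaler_eq0 (negPf y0) orbF.
by rewrite subr_eq0 => /eqP.
Qed.

Lemma scalar_map_add : {morph t : a a' / a + a'}.
Proof.
move=> a a'; apply: (scal_inj (A_neq0 e0_neq0)).
by rewrite /= -AZ !scalerDl AD !AZ.
Qed.

Lemma scalar_map_mul : {morph t : a a' / a * a'}.
Proof.
move=> a a'; apply: (scal_inj (A_neq0 e0_neq0)).
by rewrite /= -AZ -!scalerA !AZ.
Qed.

Lemma scalar_map_one : t 1 = 1.
Proof. by apply: (scal_inj (A_neq0 e0_neq0)); rewrite /= -AZ !scale1r. Qed.

Let t0 : t 0 = 0 := additive0 scalar_map_add.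

Let tN a : t (- a) = - t a := additiveN scalar_map_add a.

Let bD e f f' : b e (f + f') = b e f + b e f'.
Proof. by have := pairing_linr pair 1 e f f'; rewrite scale1r mul1r. Qed.

Let bZ a e f : b e (a *: f) = a * b e f.
Proof.
by have := pairing_linr pair a e f 0; rewrite (additive0 (bD e)) !addr0.
Qed.

Let bNl e f : b (- e) f = - b e f.
Proof.
apply: (additiveN (h := b^~ f)) => e1 e2.
by have := pairing_linl pair 1 e1 e2 f; rewrite scale1r mul1r.
Qed.

Let rhoD T e e' : rho T (e + e') = rho T e + rho T e'.
Proof. by have := rep_lin pair T 1 e e'; rewrite !scale1r. Qed.

Let rho0 T : rho T 0 = 0 := additive0 (rhoD T).

Let rhoZ T a e : rho T (a *: e) = a *: rho T e.
Proof. by have := rep_lin pair T a e 0; rewrite rho0 !addr0. Qed.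

Let sepl_N1 e : e != 0 -> exists f, b e f = -1.
Proof.
move=> /(pairing_sepl pair)[f ef]; exists (-1 *: f); by rewrite bZ ef mulr1.
Qed.

Let sepr_N1 f : f != 0 -> exists e, b e f = -1.
Proof.
by move=> /(pairing_sepr pair)[e ef]; exists (- e); rewrite bNl ef.
Qed.

(** Let S = phi T. Every vector of Y is some A e, and a suitable f makes the
perturbation of S by A e and C f fail to be semi-invertible; so S cannot be
bounded below with a range missing A e. Dually, every functional on Y is some
C f, so S cannot be onto with a kernel on which C f does not vanish. Once S
is invertible, the values -1 of both sides correspond, and semilinearity
extends this to all values. *)
Lemma phi_inverses T T' : inverses T T' ->
  exists2 S, inverses (phi T) S &
    forall e f, C f (S (A e)) = t (b (rho T' e) f).
Proof.
move=> TT'; have T'T := inverses_sym TT'.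
have crit e f : semi_invertible (phi T + rank1 (A e) (C f)) <->
    b (rho T' e) f != -1.
  rewrite -phi_OP -phiD; split=> [/phi_semi|h].
    by move/(rank_one_semi pair _ _ TT').
  by apply/phi_semi/(rank_one_semi pair _ _ TT').
have rho_neq0 e : e != 0 -> rho T' e != 0.
  apply: contra => /eqP r0.
  by rewrite -(rep_inverses pair T'T e) r0 rho0.
have [S TS] : exists S, inverses (phi T) S.
  have [bT|bT] : semi_invertible (phi T).
    by apply/phi_semi; left; exact: inverses_bounded_below TT'.1.
  - apply: inverses_of_bounded_below => // y; apply: contrapT => ny.
    have y0 : Ai y != 0.
      by apply/eqP => y0; apply: ny; exists 0; rewrite app0 -[y]AiK y0 A0.
    have [f ef] := sepl_N1 (rho_neq0 _ y0).
    have /crit : semi_invertible (phi T + rank1 (A (Ai y)) (C f)).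
      by left; rewrite AiK; exact: bounded_below_perturb_out.
    by rewrite ef eqxx.
  - apply: inverses_of_bounded_onto => // y Ty; apply: contrapT => /eqP y0.
    have [g gy] := separating_functional y0; have [f fg] := C_surj g.
    have fn0 : f != 0.
      apply/eqP => f00; have [_ /eqP] := functional_eq1_neq0 gy.
      by rewrite -fg f00 C0.
    have [e ef] := sepr_N1 fn0.
    have /crit : semi_invertible (phi T + rank1 (A (rho T e)) (C f)).
      by right; apply: (bounded_onto_perturb_ker _ bT Ty); rewrite fg.
    by rewrite (rep_inverses pair TT') ef eqxx.
exists S => // e f.
have critN1 e' f' : C f' (S (A e')) = -1 <-> b (rho T' e') f' = -1.
  have h1 := crit e' f'; have h2 := semi_invertible_perturb (A e') (C f') TS.
  split=> h; apply/eqP; apply: contrapT => /negP.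
    by move/h1/h2; rewrite h eqxx.
  by move/h2/h1; rewrite h eqxx.
have nonzero e' f' : b (rho T' e') f' != 0 ->
    C f' (S (A e')) = t (b (rho T' e') f').
  set a := b _ _ => a0.
  have : C ((- a^-1) *: f') (S (A e')) = -1.
    by apply/critN1; rewrite bZ mulNr mulVf.
  rewrite CZ bopZE tN => h.
  have ta : t a * t a^-1 = 1 by rewrite -scalar_map_mul divff// scalar_map_one.
  have {}h : t a^-1 * (C f' (S (A e')) : R[i]) = 1.
    by apply: oppr_inj; rewrite -h -mulNr.
  by rewrite -[LHS]mul1r -ta -mulrA h mulr1.
(* The value 0 is reached as the difference of two values equal to 1. *)
have [b0|] := eqVneq (b (rho T' e) f) 0; last exact: nonzero.
rewrite b0 t0; have [->|en0] := eqVneq e 0; first by rewrite A0 !app0.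
have [f' ef'] := pairing_sepl pair (rho_neq0 _ en0).
have h1 := nonzero e f'; rewrite ef' oner_neq0 scalar_map_one in h1.
have h2 := nonzero e (f + f'); rewrite bD b0 ef' add0r oner_neq0 scalar_map_one in h2.
have := h2 isT; rewrite CD bopDE h1// => h.
by apply: (addIr 1); rewrite h add0r.
Qed.

Let id_inverses : inverses (idop X) (idop X).
Proof. by split. Qed.

Lemma dual_ext (y z : Y) : (forall f, C f y = C f z) -> y = z.
Proof.
move=> yz; apply/eqP; rewrite -subr_eq0; apply: contrapT => /negP.
move=> /separating_functional[g gyz]; have [f fg] := C_surj g.
move/eqP: gyz; rewrite -fg appB yz subrr eq_sym; apply/negP.
exact: oner_neq0.
Qed.

Variable B' : 'B(Y).
Let B := phi (idop X).
Hypothesis BB' : inverses B B'.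
Hypothesis C_B' : forall e f, C f (B' (A e)) = t (b e f).

Let V y := Ai (B y).
Let Vi e := B' (A e).

Let ViK : cancel Vi V.
Proof. by move=> e; rewrite /V /Vi BB'.2 AK. Qed.

Let VK : cancel V Vi.
Proof. by move=> y; rewrite /V /Vi AiK BB'.1. Qed.

Lemma phi_formula T y : phi T y = A (rho T (V y)).
Proof.
have formula_inv T1 T' : inverses T1 T' -> phi T1 y = A (rho T1 (V y)).
  move=> TT'; have [S [SK KS] CS] := phi_inverses TT'.
  have SA e : S (A (rho T1 e)) = B' (A e).
    apply: dual_ext => f.
    by rewrite CS C_B' (rep_inverses pair TT').
  by rewrite -[RHS]KS SA /V AiK BB'.1.
(* T is the sum of T - n and n, both invertible for large n. *)
have [n nT] : exists n : nat, opnorm T < n.+1%:R.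
  exists (Num.bound (opnorm T)).
  by rewrite (lt_le_trans (archi_boundP (opnorm_ge0 T)))// ler_nat.
have c0 : (n.+1%:R : R[i]) != 0 by rewrite pnatr_eq0.
have [|S TS] := @neumann R X T n.+1%:R.
  rewrite (lt_le_trans nT)// -(rmorph_nat (real_complex R)) rnormC.
  by rewrite ger0_norm.
have -> : T = (T - n.+1%:R *: idop X) + n.+1%:R *: idop X by rewrite subrK.
rewrite phiD bopDE (formula_inv _ _ TS) (formula_inv _ _ (inverses_scale X c0)).
by rewrite -AD -(rep_add pair).
Qed.

Let W T y := Vi (rho T (Ai y)).

(** W T is the inverse of phi T', whose norm is given by the maximum modulus. *)
Lemma phi_inverse_norm T T' : inverses T T' ->
  exists2 S : 'B(Y), S =1 W T & opnorm S = opnorm T.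
Proof.
move=> TT'; have T'T := inverses_sym TT'.
have [S phiS _] := phi_inverses T'T.
exists S => [y|].
  rewrite -[RHS]phiS.1 phi_formula /W ViK (rep_inverses pair TT') AiK.
  by [].
apply: invr_inj.
rewrite -(max_modulus_inverses (A_neq0 e0_neq0) phiS) phi_max.
by rewrite (max_modulus_inverses x0_neq0 T'T).
Qed.

Let ViZ a e : Vi (a *: e) = t a *: Vi e.
Proof. by rewrite /Vi AZ appZ. Qed.

Let ViD e e' : Vi (e + e') = Vi e + Vi e'.
Proof. by rewrite /Vi AD appD. Qed.

Let opnorm_id : 0 < opnorm (idop X).
Proof. exact: opnorm_gt0_cancel x0_neq0 id_inverses.1. Qed.

Let opnormZ (Z : normedModType R[i]) a (T : 'B(Z)) :
  opnorm (a *: T) = rnorm (a : R[i]^o) * opnorm T.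
Proof. by rewrite -!bop_rnormE rnormZE. Qed.

Lemma scalar_map_norm a : `|t a| = `|a|.
Proof.
have [->|a0] := eqVneq a 0; first by rewrite t0.
have [Sa SaE Sn] := phi_inverse_norm (inverses_scale X a0).
have [S1 S1E S1n] := phi_inverse_norm id_inverses.
have SaS1 : Sa = t a *: S1.
  apply: bop_ext => y; rewrite bopZE SaE S1E /W (rep_scalar pair) ViZ.
  congr (_ *: Vi _).
  by have := rep_scalar pair 1 (Ai y); rewrite !scale1r.
move: Sn; rewrite SaS1 !opnormZ S1n.
move=> /(mulIf (lt0r_neq0 opnorm_id)) h.
by rewrite -[LHS]Re_normE -[RHS]Re_normE; congr (_%:C); exact: h.
Qed.

Let g f : dual Y := compop (C f) B'.

Let gE f y : g f y = t (b (Ai y) f).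
Proof. by rewrite compopE -C_B' AiK. Qed.

Let g_norm f y : rnorm (g f y) = rnorm (b (Ai y) f : R[i]^o).
Proof. by rewrite gE /rnorm scalar_map_norm. Qed.

(** The rank one operator OP e f is a limit of the invertible r + OP e f, on
which W is isometric. *)
Lemma rank_one_image_norm e f : rnorm (Vi e) * opnorm (g f) = rnorm e * rnorm f.
Proof.
rewrite -opnorm_rank1 -(rank_one_norm pair).
suff close (h : R) : 0 < h ->
    `|opnorm (rank1 (Vi e) (g f)) - opnorm (OP e f)| <= h.
  apply/eqP; rewrite -subr_eq0 -normr_le0; apply/ler_addgt0Pl => h h0.
  by rewrite addr0; exact: close.
move=> h0.
have [r [r0 rh bn]] : exists r : R,
    [/\ 0 < r, r <= h / (2 * opnorm (idop X)) & b e f != - r%:C].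
  (* Halving avoids the only value of r for which r + OP e f is singular. *)
  set k := h / _; have k0 : 0 < k by rewrite divr_gt0// mulr_gt0.
  have [bk|bk] := eqVneq (b e f) (- k%:C); last by exists k.
  exists (k / 2); split; [by rewrite divr_gt0|lra|].
  rewrite bk eqr_opp; apply/eqP => /(@complexI R) kk; move: k0; rewrite kk; lra.
have rC0 : r%:C != 0 :> R[i].
  by apply/eqP => /(@complexI R) rr; move: r0; rewrite rr ltxx.
have [T' TT'] := rank_one_shift pair rC0 bn.
have [S SE Sn] := phi_inverse_norm TT'.
have [S1 S1E S1n] := phi_inverse_norm (inverses_scale X rC0).
have dec : S = S1 + rank1 (Vi e) (g f).
  apply: bop_ext => y; rewrite bopDE SE S1E rank1E gE /W (rep_add pair).
  by rewrite ViD (rep_rank_one pair) ViZ.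
have n1 : opnorm (r%:C *: idop X) <= h / 2.
  rewrite opnormZ rnormC (ger0_norm (ltW r0)).
  by move: rh; rewrite ler_pdivlMr ?mulr_gt0// mulrCA; lra.
have tri (Z : normedModType R[i]) (P Q : 'B(Z)) :
    opnorm (P + Q) <= opnorm P + opnorm Q /\ opnorm Q <= opnorm (P + Q) + opnorm P.
  rewrite -!bop_rnormE; split; first exact: rnormD.
  by rewrite -{1}[Q](addKr P) addrC (le_trans (rnormD _ _))// rnormN.
have [a1 a2] := tri _ (r%:C *: idop X) (OP e f).
have [b1 b2] := tri _ S1 (rank1 (Vi e) (g f)).
rewrite -dec Sn S1n in b1 b2.
rewrite ler_norml; apply/andP; split; lra.
Qed.

(* The product rnorm (Vi e) * opnorm (g f) being rnorm e * rnorm f, each factor is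
   a multiple of the corresponding norm; k is the common ratio for Vi. *)
Let k := rnorm f0 / opnorm (g f0).

Let gf0 : 0 < opnorm (g f0).
Proof.
rewrite lt_neqAle opnorm_ge0 andbT eq_sym; apply/eqP => h.
have := rank_one_image_norm e0 f0; rewrite h mulr0 => /esym/eqP.
by rewrite mulf_eq0 !rnorm_eq0 (negPf e0_neq0) (negPf f0_neq0).
Qed.

Let k0 : 0 < k.
Proof. by rewrite divr_gt0// rnorm_gt0. Qed.

Lemma Vi_scaling e : rnorm (Vi e) = k * rnorm e.
Proof.
apply: (mulIf (lt0r_neq0 gf0)); rewrite rank_one_image_norm /k.
by rewrite mulrAC divfK ?lt0r_neq0// mulrC.
Qed.

Lemma g_scaling f : k * opnorm (g f) = rnorm f.
Proof.
have n0 : rnorm e0 != 0 by rewrite rnorm_eq0.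
by apply: (mulfI n0); rewrite -rank_one_image_norm Vi_scaling mulrCA mulrA.
Qed.

(** The upper bound on Ai y is tested on F, whose elements norm E. The lower
bound uses a norming functional at y, which is g f for some f. *)
Lemma Ai_scaling y : k * rnorm (Ai y) = rnorm y.
Proof.
have kn0 : 0 <= k^-1 by rewrite invr_ge0 ltW.
apply/eqP; rewrite eq_le; apply/andP; split.
  rewrite -ler_pdivlMl//; apply: (pairing_norming pair).
    by rewrite mulr_ge0// rnorm_ge0.
  move=> f; rewrite -g_norm -g_scaling (le_trans (opnormP _ _))//.
  by rewrite mulrACA mulVf ?lt0r_neq0// mul1r mulrC.
have [->|y0] := eqVneq y 0.
  by rewrite rnorm0 mulr_ge0 ?rnorm_ge0// ltW.
have [h [hy h1]] := norming_functional y0.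
have [f fh] := C_surj (compop h B).
have gfh : g f = h by apply: bop_ext => z; rewrite compopE fh compopE BB'.2.
have -> : rnorm y = rnorm (g f y).
  by rewrite gfh hy rnormC ger0_norm// rnorm_ge0.
rewrite g_norm (le_trans (pairing_bound pair _ _))// mulrC.
rewrite ler_wpM2r ?rnorm_ge0// -g_scaling (ler_piMr (ltW k0))//.
by rewrite gfh; apply: opnorm_le => z z1; exact: le_trans (h1 z) z1.
Qed.

Lemma isometric_form_of_factorization :
  exists (U : E -> Y) (V : Y -> E),
    [/\ bijective_isometry U, bijective_isometry V,
        both_linear_or_conj_linear U V &
        forall (T : 'B(X)) (y : Y), phi T y = U (rho T (V y))].
Proof.
have kC0 : k%:C != 0 :> R[i].
  by apply/eqP => /(@complexI R) kk; move: k0; rewrite kk ltxx.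
have tk (r : R) : t r%:C = r%:C.
  by case: (norm_preserving_rmorph scalar_map_add scalar_map_mul scalar_map_one scalar_map_norm) => ->//; exact: conjc_real.
pose U e := k%:C^-1 *: A e; pose V' y := k%:C *: V y.
have VD y z : V (y + z) = V y + V z.
  by apply: (can_inj ViK); rewrite ViD !VK.
have VZ a y : V (t a *: y) = a *: V y.
  by apply: (can_inj ViK); rewrite ViZ !VK.
have An e : rnorm (A e) = k * rnorm e by rewrite -Ai_scaling AK.
have Vn y : k * rnorm (V y) = rnorm y by rewrite -Vi_scaling VK.
have UD e e' : U (e + e') = U e + U e' by rewrite /U AD scalerDr.
have V'D y z : V' (y + z) = V' y + V' z by rewrite /V' VD scalerDr.
have isom (P Q : normedModType R[i]) (h : P -> Q) : {morph h : x y / x + y} ->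
    (forall x, rnorm (h x) = rnorm x) -> forall x y, `|h x - h y| = `|x - y|.
  by move=> hD hn x y; rewrite -(additiveN hD) -hD -!rnormE hn.
exists U, V'; split.
- split; last first.
    apply: isom => // e; rewrite /U rnormZE An -fmorphV rnormC.
    by rewrite ger0_norm ?invr_ge0 ?ltW// mulrA mulVf ?mul1r// gt_eqF.
  exists (fun y => Ai (k%:C *: y)) => [e|y]; rewrite /U.
    by rewrite scalerA divff// scale1r AK.
  by rewrite AiK scalerA mulVf// scale1r.
- split; last first.
    by apply: isom => // y; rewrite /V' rnormZE rnormC ger0_norm ?ltW.
  exists (fun e => Vi (k%:C^-1 *: e)) => [y|e]; rewrite /V'.
    by rewrite scalerA mulVf// scale1r VK.
  by rewrite ViK scalerA divff// scale1r.
- have UZ a e : U (a *: e) = t a *: U e.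
    by rewrite /U AZ !scalerA mulrC.
  have V'Z a y : V' (t a *: y) = a *: V' y.
    by rewrite /V' VZ !scalerA mulrC.
  case: (norm_preserving_rmorph scalar_map_add scalar_map_mul scalar_map_one scalar_map_norm) => tE; [left|right].
    split=> a x y; first by rewrite UD UZ tE.
    by rewrite V'D -{1}[a]tE V'Z.
  split; split=> // a x; first by rewrite UZ tE.
  by have := V'Z a^*%C x; rewrite tE conjcK.
- move=> T y; rewrite phi_formula /U /V' rhoZ AZ tk scalerA mulVf// scale1r.
  by [].
Qed.
End IsometricForm.

(** * Moduli under isometries and adjoints *)

Section AdjointModuli.
Local Open Scope classical_set_scope.
Local Open Scope complex_scope.
Context {R : realType}.
Implicit Types V W : normedModType R[i].

(** Homogeneity for real scalars is shared by linear and conjugate linear maps,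
and is all that the moduli see. *)
Definition real_isometry V W (U : V -> W) :=
  [/\ bijective U, forall x, rnorm (U x) = rnorm x &
      forall (r : R) x, U (r%:C *: x) = r%:C *: U x].

Lemma real_isometry_inv V W (U : V -> W) (U' : W -> V) :
  real_isometry U -> cancel U U' -> cancel U' U -> real_isometry U'.
Proof.
move=> [_ Un Ur] UK U'K; split; first by exists U.
  by move=> x; rewrite -Un U'K.
by move=> r x; rewrite -[RHS]UK Ur U'K.
Qed.

Lemma moduli_isometry_le V W (U : V -> W) (V' : W -> V) (T : 'B(V)) (S : 'B(W))
    (v : V) (w : W) : v != 0 -> w != 0 ->
  real_isometry U -> real_isometry V' -> (forall y, S y = U (T (V' y))) ->
  min_modulus T <= min_modulus S /\ surj_modulus T <= surj_modulus S.
Proof.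
move=> v0 w0 isoU [[V'' _ V''K] V'n _] ST; have [[U' UK U'K] Un Ur] := isoU.
have [_ U'n U'r] := real_isometry_inv isoU UK U'K.
split.
  apply/(le_min_modulus w0) => y; rewrite ST Un -V'n.
  by move: (V' y); apply/(le_min_modulus v0).
apply: (surj_modulus_le) => e e0 eT; apply: (le_surj_modulus w0) => // y.
have [x Tx xy] := eT (U' y); exists (V'' x).
  by rewrite ST V''K Tx Ur U'K.
by rewrite -V'n V''K -U'n.
Qed.

Lemma moduli_isometry V W (U : V -> W) (V' : W -> V) (T : 'B(V)) (S : 'B(W))
    (v : V) (w : W) : v != 0 -> w != 0 ->
  real_isometry U -> real_isometry V' -> (forall y, S y = U (T (V' y))) ->
  min_modulus S = min_modulus T /\ surj_modulus S = surj_modulus T.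
Proof.
move=> v0 w0 isoU isoV' ST.
have [[U' UK U'K] _ _] := isoU; have [[V'' V'K V''K] _ _] := isoV'.
have TS x : T x = U' (S (V'' x)) by rewrite ST V''K UK.
have [m1 q1] := moduli_isometry_le v0 w0 isoU isoV' ST.
have [m2 q2] := moduli_isometry_le w0 v0 (real_isometry_inv isoU UK U'K)
  (real_isometry_inv isoV' V'K V''K) TS.
by split; apply/eqP; rewrite eq_le; apply/andP.
Qed.

Lemma min_modulus_ge0 V (v : V) (T : 'B(V)) : v != 0 -> 0 <= min_modulus T.
Proof.
by move=> v0; apply/(le_min_modulus v0) => z; rewrite mul0r rnorm_ge0.
Qed.

Lemma dual_neq0 V (v : V) : v != 0 -> exists f : dual V, f != 0.
Proof.
move=> /separating_functional[f fv]; exists f.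
by have [] := functional_eq1_neq0 fv.
Qed.

Lemma surj_le_min_adjoint V (v : V) (T : 'B(V)) : v != 0 ->
  surj_modulus T <= min_modulus (adjoint T).
Proof.
move=> v0; have [f0 f0n] := dual_neq0 v0.
apply: surj_modulus_le => e e0 eT; apply/(le_min_modulus f0n) => f.
have [->|en0] := eqVneq e 0; first by rewrite mul0r rnorm_ge0.
have ep : 0 < e by rewrite lt_neqAle eq_sym en0.
rewrite mulrC -ler_pdivlMr// bop_rnormE; apply: opnorm_le => y y1.
rewrite ler_pdivlMr// -{1}(ger0_norm e0) -rnormC mulrC -rnormM -dualZ.
have [x <- xy] := eT y; rewrite -[f _]/(adjoint T f x) bop_rnormE opnorm_ub//.
exact: le_trans xy y1.
Qed.

(** The functional sending T x to c f x on the range of T is bounded by the norm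
of f, because c |x| <= |T x|; an extension with the same bound is a preimage
of c f under the adjoint. *)
Lemma min_le_surj_adjoint V (v : V) (T : 'B(V)) : v != 0 ->
  min_modulus T <= surj_modulus (adjoint T).
Proof.
move=> v0; have [f0 f0n] := dual_neq0 v0.
have m0 := min_modulus_ge0 T v0; set c := min_modulus T in m0 *.
have cT : forall z, c * rnorm z <= rnorm (T z) by apply/(le_min_modulus v0).
apply: (le_surj_modulus f0n) => // f.
have [||_ _ [x [-> ->]]|g [gG gb]] := hahn_banach_graph (opnorm_ge0 f)
  (G := fun y a => exists x, y = T x /\ a = c%:C * (f x : R[i])).
- by exists 0; rewrite !app0 mulr0.
- move=> _ _ _ _ a [x [-> ->]] [y [-> ->]]; exists (a *: x + y).
  by rewrite (appD T) (appZ T) (appD f) dualZ mulrDr mulrCA.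
- rewrite -/(rnorm (_ : R[i]^o)) rnormM rnormC ger0_norm//.
  rewrite (@le_trans _ _ (c * (opnorm f * rnorm x)))//.
    by rewrite ler_wpM2l// opnormP.
  by rewrite mulrCA ler_wpM2l// opnorm_ge0.
exists g.
  by apply: bop_ext => x; rewrite adjointE bopZE; apply: gG; exists x.
rewrite !bop_rnormE; apply: opnorm_le => x x1.
by rewrite (le_trans (gb x))// ler_piMr// opnorm_ge0.
Qed.

(** If f is a norming functional at x, then e f is the composite of T with some
g of norm at most one, so e |x| = g (T x) is at most |T x|. *)
Lemma surj_adjoint_le_min V (v : V) (T : 'B(V)) : v != 0 ->
  surj_modulus (adjoint T) <= min_modulus T.
Proof.
move=> v0; apply: surj_modulus_le => e e0 eT; apply/(le_min_modulus v0) => x.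
have [->|x0] := eqVneq x 0; first by rewrite rnorm0 mulr0 rnorm_ge0.
have [f [fx f1]] := norming_functional x0; have [g Tg gf] := eT f.
have -> : e * rnorm x = rnorm (g (T x)).
  rewrite -[g _]/(adjoint T g x) Tg bopZE fx rnormZE !rnormC !ger0_norm//.
  exact: rnorm_ge0.
rewrite (le_trans (opnormP g _))// ler_piMl ?rnorm_ge0//.
rewrite -bop_rnormE (le_trans gf)// bop_rnormE; apply: opnorm_le => y y1.
exact: le_trans (f1 y) y1.
Qed.

Lemma bidual_norm V (x : V) : rnorm (bidual_embedding x) = rnorm x.
Proof.
apply/eqP; rewrite eq_le; apply/andP; split.
  rewrite bop_rnormE; apply: opnorm_le => f f1.
  by rewrite (le_trans (opnormP f x))// ler_piMl ?rnorm_ge0.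
apply: norming_dual; first exact: rnorm_ge0.
by move=> f; exact: (opnormP (bidual_embedding x) f).
Qed.

(** The two moduli are exchanged. One inequality, that the minimum modulus of
the adjoint is at most the surjectivity modulus of T, comes from applying the
preceding lemmas to the adjoint: in a reflexive space the second adjoint is T
up to an isometry. *)
Lemma adjoint_max_modulus V (v : V) (T : 'B(V)) : v != 0 -> reflexive_space V ->
  max_modulus (adjoint T) = max_modulus T.
Proof.
move=> v0 reflV; have [f f0] := dual_neq0 v0; have [F F0] := dual_neq0 f0.
have J_surj (G : dual (dual V)) : exists x, bidual_embedding x = G.
  by have : range (@bidual_embedding R V) G; [rewrite reflV|case=> x _ <-; exists x].
have JD (x y : V) : bidual_embedding (x - y) = bidual_embedding x - bidual_embedding y.
  by apply: bop_ext => g; rewrite bopBE /= appB.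
have [J' J'K] := choice J_surj.
have JK : cancel (@bidual_embedding R V) J'.
  move=> x; apply/eqP; rewrite -subr_eq0; apply/eqP/rnorm0_eq0.
  by rewrite -bidual_norm JD J'K subrr rnorm0.
have isoJ : real_isometry (@bidual_embedding R V).
  split; [by exists J'|exact: bidual_norm|] => r x.
  by apply: bop_ext => g; rewrite bopZE /= appZ.
have [|_ q2] := moduli_isometry v0 F0 isoJ (real_isometry_inv isoJ JK J'K)
  (T := T) (S := adjoint (adjoint T)).
  by move=> G; apply: bop_ext => g; rewrite -{1}[G]J'K.
have mq : min_modulus (adjoint T) = surj_modulus T.
  apply/eqP; rewrite eq_le (surj_le_min_adjoint T v0) andbT -q2.
  exact: min_le_surj_adjoint f0.
have qm : surj_modulus (adjoint T) = min_modulus T.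
  by apply/eqP; rewrite eq_le (surj_adjoint_le_min T v0) (min_le_surj_adjoint T v0).
by rewrite /max_modulus mq qm maxC.
Qed.

End AdjointModuli.

(** * The adjoint form and reflexivity *)

Section Reflexivity.
Local Open Scope classical_set_scope.
Local Open Scope complex_scope.
Context {R : realType}.
Implicit Types V W : normedModType R[i].

Lemma linear_add V W (U : V -> W) : linear U -> {morph U : x y / x + y}.
Proof. by move=> lU x y; have := lU 1 x y; rewrite !scale1r. Qed.

Lemma linear_scale V W (U : V -> W) : linear U ->
  forall (a : R[i]) x, U (a *: x) = a *: U x.
Proof.
move=> lU a x.
by have := lU a x 0; rewrite (additive0 (linear_add lU)) !addr0.
Qed.

(** The map c is the identity or the conjugation; stating what they share avoids
proving each consequence twice. *)
Lemma semilinear_pair V W V' W' (U : V -> W) (U' : V' -> W') :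
  both_linear_or_conj_linear U U' ->
  exists c : R[i] -> R[i],
    [/\ {morph c : a b / a + b}, {morph c : a b / a * b}, involutive c,
        forall a : R[i], `|c a| = `|a| & forall r : R, c r%:C = r%:C] /\
    [/\ {morph U : x y / x + y}, {morph U' : x y / x + y},
        forall a x, U (a *: x) = c a *: U x &
        forall a x, U' (a *: x) = c a *: U' x].
Proof.
case=> -[lU lU']; [exists id|exists (@conjc R)]; split.
- by split.
- split; [exact: linear_add lU|exact: linear_add lU'|exact: linear_scale lU|].
  exact: linear_scale lU'.
- split; [exact: rmorphD|exact: rmorphM|exact: conjcK|exact: normcJ|].
  exact: conjc_real.
- by split; [exact: lU.1|exact: lU'.1|exact: lU.2|exact: lU'.2].
Qed.

Lemma isometry_norm V W (U : V -> W) : {morph U : x y / x + y} ->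
  bijective_isometry U -> forall x, rnorm (U x) = rnorm x.
Proof.
by move=> UD [_ Un] x; have := Un x 0; rewrite (additive0 UD) !subr0 /rnorm => ->.
Qed.

Lemma isometric_form_max_modulus V W (U : V -> W) (U' : W -> V) (T : 'B(V))
    (S : 'B(W)) (v : V) (w : W) : v != 0 -> w != 0 ->
  bijective_isometry U -> bijective_isometry U' ->
  both_linear_or_conj_linear U U' -> (forall y, S y = U (T (U' y))) ->
  max_modulus S = max_modulus T.
Proof.
move=> v0 w0 iU iU' /semilinear_pair[c [[_ _ _ _ cR] [UD U'D UZ U'Z]]] ST.
have rU : real_isometry U.
  split; [exact: iU.1|exact: isometry_norm|]=> r x; by rewrite UZ cR.
have rU' : real_isometry U'.
  split; [exact: iU'.1|exact: isometry_norm|]=> r x; by rewrite U'Z cR.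
by have [m q] := moduli_isometry v0 w0 rU rU' ST; rewrite /max_modulus m q.
Qed.

Section AdjointForm.
Variables (X Y : normedModType R[i]) (phi : 'B(X) -> 'B(Y)).
Hypothesis phi_surj : forall S, exists T, phi T = S.
Variables (y0 : Y) (U : dual X -> Y) (V : Y -> dual X).
Hypotheses (y0_neq0 : y0 != 0).
Hypotheses (iU : bijective_isometry U) (iV : bijective_isometry V).
Hypothesis UV : both_linear_or_conj_linear U V.
Hypothesis phiE : forall (T : 'B(X)) (y : Y), phi T y = U (adjoint T (V y)).

(** Transporting Q to Y by U and V gives a complex linear operator even when U
and V are conjugate linear, because the two conjugations cancel. *)
Lemma every_operator_adjoint (Q : 'B(dual X)) : exists T : 'B(X), adjoint T = Q.
Proof.
have [c [[cD cM cK cn cR] [UD VD UZ VZ]]] := semilinear_pair UV.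
have bS : bounded_linear (fun y => U (Q (V y))).
  split=> [a y z|]; first by rewrite VD VZ appD appZ UD UZ cK.
  exists (opnorm Q) => y.
  by rewrite isometry_norm// (le_trans (opnormP _ _))// (isometry_norm VD iV).
have [T TE] := phi_surj (mk_bop bS); exists T; apply: bop_ext => f.
have [[U' UK _] _] := iU; have [[V' _ V'K] _] := iV.
have := congr1 (fun S : 'B(Y) => S (V' f)) TE; rewrite phiE /= V'K.
exact: (can_inj UK).
Qed.

Lemma adjoint_form_dual_neq0 : exists f : dual X, f != 0.
Proof.
have [[U' UK U'K] _] := iU.
have [c [_ [UD _ UZ _]]] := semilinear_pair UV.
exists (U' y0); apply: contra y0_neq0 => /eqP h.
by rewrite -rnorm_eq0 -[y0]U'K (isometry_norm UD iU) h rnorm0.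
Qed.

(** If the operator g |-> G(g) f is the adjoint of T and f x = 1, then
evaluating at x gives G(g) = g (T x): G is the evaluation at T x. *)
Lemma adjoint_form_reflexive : reflexive_space X.
Proof.
apply/seteqP; split=> // G _; have [f /functional_neq0[x fx]] := adjoint_form_dual_neq0.
have [T TE] := every_operator_adjoint (rank1 f G).
exists (T x) => //; apply: bop_ext => g.
have := congr1 (fun Q : 'B(dual X) => Q g x) TE.
rewrite rank1E bopZE fx adjointE /= => ->.
exact: mulr1.
Qed.

(** By reflexivity of X, every functional on Y is some k x, namely y |-> c (U^-1
y x). So G in the bidual of Y is determined by x |-> c (G (k x)), a
functional on X, whose image under U is the point that represents G. *)
Lemma adjoint_form_reflexive_codomain : reflexive_space Y.
Proof.
have reflX := adjoint_form_reflexive.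
have [c [[cD cM cK cn cR] [UD _ UZ _]]] := semilinear_pair UV.
have [[U' UK U'K] _] := iU.
have Un := isometry_norm UD iU.
have U'D x y : U' (x + y) = U' x + U' y.
  by apply: (can_inj UK); rewrite UD !U'K.
have U'Z a y : U' (a *: y) = c a *: U' y.
  by apply: (can_inj UK); rewrite UZ cK !U'K.
have U'n y : rnorm (U' y) = rnorm y by rewrite -Un U'K.
have cnr (a : R[i]^o) : rnorm (c a : R[i]^o) = rnorm a by rewrite /rnorm cn.
have bk (x : X) : bounded_linear (fun y => c (U' y x) : R[i]^o).
  split=> [a y z|]; first by rewrite U'D U'Z bopDE bopZE cD cM cK.
  exists (rnorm x) => y; rewrite cnr mulrC -U'n; exact: opnormP.
pose k x : dual Y := mk_bop (bk x).
have kE x y : k x y = c (U' y x) by [].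
apply/seteqP; split=> // G _.
have bf : bounded_linear (fun x => c (G (k x)) : R[i]^o).
  split=> [a x z|].
    have -> : k (a *: x + z) = c a *: k x + k z.
      by apply: bop_ext => y; rewrite bopDE bopZE !kE appD dualZ cD cM.
    by rewrite appD appZ cD cM cK.
  exists (opnorm G) => x; rewrite cnr (le_trans (opnormP _ _))//.
  rewrite ler_wpM2l ?opnorm_ge0// bop_rnormE; apply: opnorm_le => y y1.
  rewrite kE cnr (le_trans (opnormP _ _))// ler_piMl ?rnorm_ge0//.
  by rewrite -bop_rnormE U'n.
exists (U (mk_bop bf)) => //; apply: bop_ext => h /=.
have bh : bounded_linear (fun f : dual X => c (h (U f)) : R[i]^o).
  split=> [a f f'|]; first by rewrite UD UZ appD dualZ cD cM cK.
  by exists (opnorm h) => f; rewrite cnr (le_trans (opnormP _ _))// Un.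
have [x _ xh] : range (@bidual_embedding R X) (mk_bop bh) by rewrite reflX.
have hx (f : dual X) : f x = c (h (U f)).
  by have := congr1 (fun G' : dual (dual X) => G' f) xh.
have -> : h = k x by apply: bop_ext => y; rewrite kE hx cK U'K.
by rewrite kE UK /= cK.
Qed.
End AdjointForm.

End Reflexivity.

(** * Preservers of the maximum modulus *)

Section ModulusPreservers.
Local Open Scope complex_scope.
Context {R : realType} {X Y : completeNormedModType R[i]}.
Variables (x0 : X) (y0 : Y).
Hypotheses (x0_neq0 : x0 != 0) (y0_neq0 : y0 != 0).
Variable phi : 'B(X) -> 'B(Y).
Hypothesis phiD : {morph phi : S T / S + T}.
Hypothesis phi_surj : forall S, exists T, phi T = S.
Hypothesis phi_max : forall T, max_modulus (phi T) = max_modulus T.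

Lemma preserver_semi T : semi_invertible (phi T) <-> semi_invertible T.
Proof.
by rewrite -(max_modulus_gt0 y0_neq0) -(max_modulus_gt0 x0_neq0) phi_max.
Qed.

(** If phi T = 0 then A + T is semi-invertible whenever A is, which is false for
a suitable invertible A as soon as T is nonzero. *)
Lemma preserver_inj : injective phi.
Proof.
have ker T : phi T = 0 -> T = 0.
  move=> T0; apply/eqP; apply: contrapT => /negP Tn0.
  have [x Tx] : exists x, T x != 0.
    apply: contrapT => nx; case/eqP: Tn0; apply: bop_ext => x.
    by apply/eqP; apply: contrapT => Tx; apply: nx; exists x; exact/negP.
  have [f fTx] := separating_functional Tx.
  have [A [A' [[AK _] nAT]]] := one_defect fTx.
  apply: nAT; apply/preserver_semi; rewrite phiD T0 addr0.
  by apply/preserver_semi; left; exact: inverses_bounded_below AK.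
move=> S T ST; apply/eqP; rewrite -subr_eq0; apply/eqP/ker.
by rewrite phiD (additiveN phiD) ST subrr.
Qed.

Lemma preserver_rank_le1 T : rank_le1 (phi T) <-> rank_le1 T.
Proof.
rewrite !rank_le1P; split=> h A.
  move=> /preserver_semi/h; rewrite -!phiD.
  by case=> /preserver_semi; [left|right].
have [A' <-] := phi_surj A; move=> /preserver_semi/h; rewrite -!phiD.
by case=> /preserver_semi; [left|right].
Qed.

Hypothesis dimX : forall x : X, exists y, forall c : R[i], y <> c *: x.
Hypothesis dimY : forall x : Y, exists y, forall c : R[i], y <> c *: x.

Lemma isometric_form (E F : normedModType R[i]) (b : E -> F -> R[i])
    (OP : E -> F -> 'B(X)) (rho : 'B(X) -> E -> E) (e0 : E) (f0 : F) :
  operator_pairing b OP rho -> e0 != 0 -> f0 != 0 ->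
  (forall e, e != 0 -> exists2 u, u != 0 &
    forall T, ranged u (phi T) <-> exists f, T = OP e f) ->
  (forall f, f != 0 -> exists2 g, g != 0 &
    forall T, kerneled g (phi T) <-> exists e, T = OP e f) ->
  exists (U : E -> Y) (V : Y -> E),
    [/\ bijective_isometry U, bijective_isometry V,
        both_linear_or_conj_linear U V &
        forall (T : 'B(X)) (y : Y), phi T y = U (rho T (V y))].
Proof.
move=> pair e0_neq0 f0_neq0 Hr Hk.
have [A [C [t [[AD Abij CD Csurj] [AC AZ CZ]]]]] :=
  factorization dimY pair e0_neq0 f0_neq0 phiD preserver_inj phi_surj Hr Hk.
case: Abij => Ai AK AiK.
have id_inv : inverses (idop X) (idop X) by split.
have [B' BB' C_B] := phi_inverses pair e0_neq0 phiD preserver_semi AD AK AiK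
  CD Csurj AC AZ CZ id_inv.
have C_B' e f : C f (B' (A e)) = t (b e f).
  by have := rep_scalar pair 1 e; rewrite C_B !scale1r => ->.
exact: (isometric_form_of_factorization pair x0_neq0 e0_neq0 f0_neq0 phiD
  preserver_semi phi_max AD AK AiK CD Csurj AC AZ CZ BB' C_B').
Qed.

Lemma preserver_form : direct_form phi \/ adjoint_form phi.
Proof.
have [f0 f0_neq0] := dual_neq0 x0_neq0.
have := line_types dimX dimY phiD preserver_inj phi_surj preserver_rank_le1.
case=> -[Hr Hk]; [left|right].
  exact: isometric_form direct_pairing x0_neq0 f0_neq0 Hr Hk.
exact: isometric_form adjoint_pairing f0_neq0 x0_neq0 Hk Hr.
Qed.

End ModulusPreservers.

Lemma infinite_dimensional_gt1 (R : realType) (V : normedModType R[i]) :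
  infinite_dimensional V ->
  forall x : V, exists y, forall c : R[i], y <> c *: x.
Proof.
move=> infV x; apply: contrapT => nx; apply: infV.
exists 1%N, (fun=> x) => y; apply: contrapT => ny; apply: nx; exists y => c yc.
by apply: ny; exists (fun=> c); rewrite big_ord1.
Qed.

Theorem theorem3p2 (R : realType) (X Y : completeNormedModType R[i])
    (X_infdim : infinite_dimensional X) (Y_infdim : infinite_dimensional Y)
    (phi : 'B(X) -> 'B(Y))
    (phi_additive : {morph phi : S T / S + T})
    (phi_surjective : forall S : 'B(Y), exists T : 'B(X), phi T = S) :
  ((forall T : 'B(X), max_modulus (phi T) = max_modulus T) <->
   direct_form phi \/ adjoint_form phi) /\
  (~ reflexive_space X \/ ~ reflexive_space Y -> ~ adjoint_form phi).
Proof.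
have dimX := infinite_dimensional_gt1 X_infdim.
have dimY := infinite_dimensional_gt1 Y_infdim.
have [x0 nx0] := dimX 0; have [y0 ny0] := dimY 0.
have x0_neq0 := nonproportional_neq0 nx0.
have y0_neq0 := nonproportional_neq0 ny0.
split; last first.
  move=> nrefl [U [V [iU iV UV phiE]]].
  case: nrefl; apply.
    exact: (adjoint_form_reflexive phi_surjective y0_neq0 iU iV UV phiE).
  exact: (adjoint_form_reflexive_codomain phi_surjective y0_neq0 iU iV UV phiE).
split=> [phi_max|].
  exact: (preserver_form x0_neq0 y0_neq0 phi_additive phi_surjective phi_max
    dimX dimY).
case=> -[U [V [iU iV UV phiE]]] T.
  exact: (isometric_form_max_modulus x0_neq0 y0_neq0 iU iV UV (phiE T)).
have reflX := adjoint_form_reflexive phi_surjective y0_neq0 iU iV UV phiE.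
have [f0 f0_neq0] := dual_neq0 x0_neq0.
rewrite (isometric_form_max_modulus f0_neq0 y0_neq0 iU iV UV (phiE T)).
exact: adjoint_max_modulus x0_neq0 reflX.
Qed.
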